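(* Let $R$ be a PID and let $(X,r)$ be a ray-based, metrizable generalized continuum. There is a splitting $$H^{\ast}_{\mathrm e}(X)\cong \widetilde H^{\ast}_{\mathrm e}(X)\oplus H^{\ast}_{\mathrm e}([0,\infty))$$ (of graded $R$-modules) that is natural in $(X,r)$ for ray-based proper maps. In each positive dimension $k$, $H^{k}_{\mathrm e}(X)\cong\widetilde H^{k}_{\mathrm e}(X)$.
   Context: Spaces are Hausdorff and maps are continuous. A map is proper if preimages of compacta are compact. A generalized continuum is a Hausdorff space that is connected, locally connected, $\sigma$-compact, and locally compact. A baseray in $X$ is a proper embedding $r:[0,\infty)\to X$ (identified with its image, which is closed). A ray-based space is a pair $(X,r)$ with $r$ a baseray in $X$. A proper map $f:Y\to X$ between ray-based spaces $(Y,s)$ and $(X,r)$ is ray-based if $r=f\circ s$. Cohomology is singular with coefficients in $R$. For a generalized continuum $X$ and a closed subspace $A\subseteq X$, the end cohomology algebra is $H^{\ast}_{\mathrm e}(X,A)=\varinjlim_K H^{\ast}(X-K,A-K)$, the direct limit over compacta $K\subseteq X$ ordered by inclusion with restriction homomorphisms; $H^{\ast}_{\mathrm e}(X)=H^{\ast}_{\mathrm e}(X,\emptyset)$. It is contravariantly functorial for proper maps of closed pairs. Reduced end cohomology is $\widetilde H^{\ast}_{\mathrm e}(X)=H^{\ast}_{\mathrm e}(X,r)$. Naturality means that the splitting isomorphisms commute with the homomorphisms induced by ray-based proper maps $(Y,s)\to(X,r)$ between ray-based, metrizable generalized continua. *)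

(* Defs.v *)
From HB Require Import structures.
From mathcomp Require Import all_boot all_order all_algebra.
From mathcomp Require Import generic_quotient ring_quotient.
From mathcomp Require Import all_classical all_reals all_analysis.

Set Implicit Arguments.
Unset Strict Implicit.
Unset Printing Implicit Defensive.

Import Order.TTheory GRing.Theory Num.Theory.
Import numFieldNormedType.Exports.

Local Open Scope classical_set_scope.
Local Open Scope ring_scope.
Local Open Scope quotient_scope.

Definition is_ideal (R : comNzRingType) (I : set R) : Prop :=
  [/\ I 0, forall x y, I x -> I y -> I (x + y) & forall a x, I x -> I (a * x)].

Definition is_pid (R : idomainType) : Prop :=
  forall I : set R, is_ideal I -> exists a, I = [set x * a | x in [set: R]].

Section QuotientModule.
Variables (R : pzRingType) (V : lmodType R) (S : submodClosed V).

(** [submodClosed] does not inherit from [zmodClosed], which [Quotient.quot]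
    expects. *)
Definition submod_zmod : V -> bool := fun x => x \in S.

Fact submod_zmod_closed : zmod_closed submod_zmod.
Proof.
split=> [|x y xS yS]; first exact: (@rpred0 V S).
by rewrite -scaleN1r; apply: (@rpredD V S) => //; exact: (@rpredZ R V S).
Qed.

HB.instance Definition _ :=
  GRing.isZmodClosed.Build V submod_zmod submod_zmod_closed.

Local Notation Q := (Quotient.quot (GRing.ZmodClosed.clone V submod_zmod _)).

Definition lmod_quot : Type := Q.

HB.instance Definition _ := GRing.Zmodule.on lmod_quot.

Definition lmod_class (x : V) : lmod_quot := \pi_Q x.
Definition lmod_repr (u : lmod_quot) : V := repr (u : Q).

Lemma lmod_reprK u : lmod_class (lmod_repr u) = u.
Proof. exact: reprK. Qed.

Lemma lmod_class_surj (u : lmod_quot) : exists x, u = lmod_class x.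
Proof. by exists (lmod_repr u); rewrite lmod_reprK. Qed.

Lemma lmod_classP x y : lmod_class x = lmod_class y <-> x - y \in S.
Proof.
rewrite /lmod_class; split=> [/eqP|h]; first by rewrite -Quotient.idealrBE.
by apply/eqP; rewrite -Quotient.idealrBE.
Qed.

Lemma lmod_classD x y : lmod_class (x + y) = lmod_class x + lmod_class y.
Proof. exact: (raddfD (\pi_Q : {additive V -> Q})). Qed.

Definition lmod_quot_scale a (u : lmod_quot) := lmod_class (a *: lmod_repr u).

Lemma lmod_classZ a x : lmod_class (a *: x) = lmod_quot_scale a (lmod_class x).
Proof.
apply/lmod_classP; rewrite -scalerBr rpredZ //.
by apply/lmod_classP; rewrite lmod_reprK.
Qed.

Fact lmod_quot_scaleA a b u :
  lmod_quot_scale a (lmod_quot_scale b u) = lmod_quot_scale (a * b) u.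
Proof. by rewrite -[u]lmod_reprK -!lmod_classZ scalerA. Qed.

Fact lmod_quot_scale1 : left_id 1 lmod_quot_scale.
Proof. by move=> u; rewrite -[u]lmod_reprK -!lmod_classZ scale1r. Qed.

Fact lmod_quot_scaleDr : right_distributive lmod_quot_scale +%R.
Proof.
move=> a u v; rewrite -[u]lmod_reprK -[v]lmod_reprK.
by rewrite -lmod_classD -!lmod_classZ scalerDr lmod_classD.
Qed.

Fact lmod_quot_scaleDl u : {morph lmod_quot_scale^~ u : a b / a + b}.
Proof.
move=> a b; rewrite -[u]lmod_reprK /= -!lmod_classZ scalerDl.
exact: lmod_classD.
Qed.

HB.instance Definition _ := GRing.Zmodule_isLmodule.Build R lmod_quot
  lmod_quot_scaleA lmod_quot_scale1 lmod_quot_scaleDr lmod_quot_scaleDl.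

Fact lmod_class_is_linear : linear lmod_class.
Proof. by move=> a x y; rewrite lmod_classD lmod_classZ. Qed.

HB.instance Definition _ :=
  GRing.isLinear.Build R V lmod_quot *:%R lmod_class lmod_class_is_linear.

End QuotientModule.

Section QuotientMap.
Variables (R : pzRingType) (V W : lmodType R).
Variables (S : submodClosed V) (S' : submodClosed W) (f : {linear V -> W}).
Hypothesis fS : forall x, x \in S -> f x \in S'.

Definition quot_map_fun (u : lmod_quot S) : lmod_quot S' :=
  lmod_class S' (f (lmod_repr u)).

Lemma quot_map_funE x : quot_map_fun (lmod_class S x) = lmod_class S' (f x).
Proof.
apply/lmod_classP; rewrite -raddfB; apply: fS.
by apply/lmod_classP; rewrite lmod_reprK.
Qed.

Fact quot_map_is_linear : linear quot_map_fun.
Proof.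
move=> a u v; rewrite -[u]lmod_reprK -[v]lmod_reprK.
rewrite -linearP /=.
rewrite !quot_map_funE.
by rewrite linearP linearP.
Qed.

Definition quot_map : {linear lmod_quot S -> lmod_quot S'} :=
  HB.pack quot_map_fun
    (GRing.isLinear.Build _ _ _ _ quot_map_fun quot_map_is_linear).

Lemma quot_mapE x : quot_map (lmod_class S x) = lmod_class S' (f x).
Proof. exact: quot_map_funE. Qed.

End QuotientMap.

Record dirsys (R : pzRingType) := DirSys {
  ds_index : choiceType;
  ds_le : ds_index -> ds_index -> Prop;
  ds_refl : forall i, ds_le i i;
  ds_trans : forall i j k, ds_le i j -> ds_le j k -> ds_le i k;
  ds_inhab : ds_index;
  ds_directed : forall i j, exists k, ds_le i k /\ ds_le j k;
  ds_obj : ds_index -> lmodType R;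
  ds_map : forall i j, ds_le i j -> {linear ds_obj i -> ds_obj j};
  ds_map_id : forall i (h : ds_le i i) x, ds_map h x = x;
  ds_map_comp : forall i j k (hij : ds_le i j) (hjk : ds_le j k)
    (hik : ds_le i k) x, ds_map hjk (ds_map hij x) = ds_map hik x }.

Section DirectLimit.
Variables (R : pzRingType) (D : dirsys R).
Local Notation I := (ds_index D).
Local Notation M := (@ds_obj R D).

(** As the index preorder is directed, the direct limit is the disjoint union
    of the modules in which two elements are identified when they have the
    same image further along the system. *)
Definition dirlim_equiv (u v : {i : I & M i}) : bool :=
  `[< exists k (hu : ds_le (tag u) k) (hv : ds_le (tag v) k),
        ds_map hu (tagged u) = ds_map hv (tagged v) >].

Fact dirlim_equiv_refl : reflexive dirlim_equiv.
Proof.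
move=> u; apply/asboolP; exists (tag u).
by exists (ds_refl _), (ds_refl _).
Qed.

Fact dirlim_equiv_sym : symmetric dirlim_equiv.
Proof.
by move=> u v; apply/asboolP/asboolP => -[k [hu [hv e]]]; exists k, hv, hu.
Qed.

Fact dirlim_equiv_trans : transitive dirlim_equiv.
Proof.
move=> v u w /asboolP[k [hu [hv e]]] /asboolP[l [hv' [hw e']]].
have [m [hk hl]] := ds_directed k l.
apply/asboolP; exists m, (ds_trans hu hk), (ds_trans hw hl).
rewrite -(ds_map_comp hu hk) e -(ds_map_comp hw hl) -e'.
by rewrite !(ds_map_comp _ _ (ds_trans hv hk)).
Qed.

Canonical dirlim_equiv_rel :=
  EquivRel dirlim_equiv dirlim_equiv_refl dirlim_equiv_sym dirlim_equiv_trans.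

Definition dirlim : Type := {eq_quot dirlim_equiv}.

HB.instance Definition _ := Choice.on dirlim.

Definition dirlim_in (i : I) (x : M i) : dirlim :=
  \pi_({eq_quot dirlim_equiv}) (Tagged (@ds_obj R D) x).

Lemma dirlim_inP i j (x : M i) (y : M j) : dirlim_in x = dirlim_in y <->
  exists k (hi : ds_le i k) (hj : ds_le j k), ds_map hi x = ds_map hj y.
Proof.
rewrite /dirlim_in; split=> [/eqP|h]; last first.
  by apply/eqP; rewrite eqmodE; exact/asboolP.
by rewrite eqmodE => /asboolP.
Qed.

Lemma dirlim_in_map i j (h : ds_le i j) (x : M i) :
  dirlim_in (ds_map h x) = dirlim_in x.
Proof.
apply/dirlim_inP; exists j, (ds_refl j), h.
by rewrite ds_map_id.
Qed.

Lemma dirlim_surj (u : dirlim) : exists i (x : M i), u = dirlim_in x.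
Proof.
exists (tag (repr (u : {eq_quot dirlim_equiv}))).
exists (tagged (repr (u : {eq_quot dirlim_equiv}))).
rewrite /dirlim_in -[LHS](reprK (u : {eq_quot dirlim_equiv})).
by case: (repr _).
Qed.

Lemma dirlim_surj2 (u v : dirlim) :
  exists i (x y : M i), u = dirlim_in x /\ v = dirlim_in y.
Proof.
have [i [x ->]] := dirlim_surj u; have [j [y ->]] := dirlim_surj v.
have [k [hi hj]] := ds_directed i j.
by exists k, (ds_map hi x), (ds_map hj y); rewrite !dirlim_in_map.
Qed.

Lemma dirlim_surj3 (u v w : dirlim) : exists i (x y z : M i),
  [/\ u = dirlim_in x, v = dirlim_in y & w = dirlim_in z].
Proof.
have [i [x [y [-> ->]]]] := dirlim_surj2 u v; have [j [z ->]] := dirlim_surj w.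
have [k [hi hj]] := ds_directed i j.
by exists k, (ds_map hi x), (ds_map hi y), (ds_map hj z); rewrite !dirlim_in_map.
Qed.

Definition dirlim_zero : dirlim := dirlim_in (0 : M (ds_inhab D)).

Definition dirlim_add (u v : dirlim) : dirlim :=
  let x := repr (u : {eq_quot dirlim_equiv}) in
  let y := repr (v : {eq_quot dirlim_equiv}) in
  let k := projT1 (cid (ds_directed (tag x) (tag y))) in
  let h := projT2 (cid (ds_directed (tag x) (tag y))) in
  dirlim_in (ds_map h.1 (tagged x) + ds_map h.2 (tagged y)).

Definition dirlim_scale (a : R) (u : dirlim) : dirlim :=
  let x := repr (u : {eq_quot dirlim_equiv}) in dirlim_in (a *: tagged x).

Definition dirlim_opp (u : dirlim) : dirlim := dirlim_scale (- 1) u.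

Lemma dirlim_in_repr (u : dirlim) :
  dirlim_in (tagged (repr (u : {eq_quot dirlim_equiv}))) = u.
Proof.
rewrite /dirlim_in -[RHS](reprK (u : {eq_quot dirlim_equiv})).
by case: (repr _).
Qed.

Lemma dirlim_addE i (x y : M i) :
  dirlim_add (dirlim_in x) (dirlim_in y) = dirlim_in (x + y).
Proof.
rewrite /dirlim_add; case: cid => k /= [h1 h2] /=.
have /dirlim_inP[l [hl1 [hl2 e1]]] := dirlim_in_repr (dirlim_in x).
have /dirlim_inP[m [hm1 [hm2 e2]]] := dirlim_in_repr (dirlim_in y).
have [n [ln mn]] := ds_directed l m; have [p [np kp]] := ds_directed n k.
have ip := ds_trans (ds_trans hl2 ln) np.
apply/dirlim_inP; exists p, kp, ip; rewrite !linearD /=.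
rewrite (ds_map_comp _ _ (ds_trans (ds_trans hl1 ln) np)).
rewrite (ds_map_comp _ _ (ds_trans (ds_trans hm1 mn) np)).
rewrite -(ds_map_comp hl1 (ds_trans ln np)) e1.
rewrite -(ds_map_comp hm1 (ds_trans mn np)) e2.
by rewrite !(ds_map_comp _ _ ip).
Qed.

Lemma dirlim_scaleE a i (x : M i) :
  dirlim_scale a (dirlim_in x) = dirlim_in (a *: x).
Proof.
rewrite /dirlim_scale.
have /dirlim_inP[l [hl1 [hl2 e1]]] := dirlim_in_repr (dirlim_in x).
by apply/dirlim_inP; exists l, hl1, hl2; rewrite !linearZ /= e1.
Qed.

Lemma dirlim_zeroE i : dirlim_zero = dirlim_in (0 : M i).
Proof.
have [k [h1 h2]] := ds_directed (ds_inhab D) i.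
by apply/dirlim_inP; exists k, h1, h2; rewrite !linear0.
Qed.

Fact dirlim_addA : associative dirlim_add.
Proof.
move=> u v w; have [i [x [y [z [-> -> ->]]]]] := dirlim_surj3 u v w.
by rewrite !dirlim_addE addrA.
Qed.

Fact dirlim_addC : commutative dirlim_add.
Proof.
move=> u v; have [i [x [y [-> ->]]]] := dirlim_surj2 u v.
by rewrite !dirlim_addE addrC.
Qed.

Fact dirlim_add0 : left_id dirlim_zero dirlim_add.
Proof.
move=> u; have [i [x ->]] := dirlim_surj u.
by rewrite (dirlim_zeroE i) dirlim_addE add0r.
Qed.

Fact dirlim_addN : left_inverse dirlim_zero dirlim_opp dirlim_add.
Proof.
move=> u; have [i [x ->]] := dirlim_surj u.
by rewrite (dirlim_zeroE i) /dirlim_opp dirlim_scaleE dirlim_addE scaleN1r addNr.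
Qed.

HB.instance Definition _ := GRing.isZmodule.Build dirlim
  dirlim_addA dirlim_addC dirlim_add0 dirlim_addN.

Fact dirlim_scaleA a b u :
  dirlim_scale a (dirlim_scale b u) = dirlim_scale (a * b) u.
Proof. by have [i [x ->]] := dirlim_surj u; rewrite !dirlim_scaleE scalerA. Qed.

Fact dirlim_scale1 : left_id 1 dirlim_scale.
Proof.
by move=> u; have [i [x ->]] := dirlim_surj u; rewrite dirlim_scaleE scale1r.
Qed.

Fact dirlim_scaleDr : right_distributive dirlim_scale +%R.
Proof.
move=> a u v; have [i [x [y [-> ->]]]] := dirlim_surj2 u v.
rewrite [in LHS]/GRing.add /= dirlim_addE !dirlim_scaleE scalerDr.
by rewrite -dirlim_addE.
Qed.

Fact dirlim_scaleDl u : {morph dirlim_scale^~ u : a b / a + b}.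
Proof.
move=> a b; have [i [x ->]] := dirlim_surj u.
by rewrite !dirlim_scaleE scalerDl -dirlim_addE.
Qed.

HB.instance Definition _ := GRing.Zmodule_isLmodule.Build R dirlim
  dirlim_scaleA dirlim_scale1 dirlim_scaleDr dirlim_scaleDl.

Fact dirlim_in_is_linear i : linear (@dirlim_in i).
Proof. by move=> a x y; rewrite -dirlim_addE -dirlim_scaleE. Qed.

HB.instance Definition _ i := GRing.isLinear.Build R (M i) dirlim *:%R
  (@dirlim_in i) (@dirlim_in_is_linear i).

End DirectLimit.

Record dirsys_mor (R : pzRingType) (D E : dirsys R) := DirsysMor {
  dm_index : ds_index D -> ds_index E;
  dm_mono : forall i j, ds_le i j -> ds_le (dm_index i) (dm_index j);
  dm_map : forall i, {linear ds_obj i -> ds_obj (dm_index i)};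
  dm_nat : forall i j (h : ds_le i j) (h' : ds_le (dm_index i) (dm_index j)) x,
    dm_map j (ds_map h x) = ds_map h' (dm_map i x) }.

Section DirectLimitMap.
Variables (R : pzRingType) (D E : dirsys R) (F : dirsys_mor D E).

Definition dirlim_map_fun (u : dirlim D) : dirlim E :=
  dirlim_in (dm_map F _ (tagged (repr (u : {eq_quot (@dirlim_equiv R D)})))).

Lemma dirlim_map_funE i (x : ds_obj i) :
  dirlim_map_fun (dirlim_in x) = dirlim_in (dm_map F i x).
Proof.
rewrite /dirlim_map_fun.
have /dirlim_inP[l [h1 [h2 e]]] := dirlim_in_repr (dirlim_in x).
apply/dirlim_inP; exists (dm_index F l), (dm_mono F h1), (dm_mono F h2).
by rewrite -!(dm_nat (d := F)) e.
Qed.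

Fact dirlim_map_is_linear : linear dirlim_map_fun.
Proof.
move=> a u v; have [i [x [y [-> ->]]]] := dirlim_surj2 u v.
by rewrite -linearP !dirlim_map_funE !linearP.
Qed.

Definition dirlim_map : {linear dirlim D -> dirlim E} :=
  HB.pack dirlim_map_fun
    (GRing.isLinear.Build _ _ _ _ dirlim_map_fun dirlim_map_is_linear).

Lemma dirlim_mapE i (x : ds_obj i) :
  dirlim_map (dirlim_in x) = dirlim_in (dm_map F i x).
Proof. exact: dirlim_map_funE. Qed.

End DirectLimitMap.

(** The topology is the subspace topology: the library puts on [set_type A]
    the initial topology of the inclusion. *)
Definition subsp (T : topologicalType) (A : set T) : topologicalType :=
  Topological.clone (set_type A) _.

Section Restriction.
Variables (S T : topologicalType) (f : continuousType S T).
Variables (U : set S) (V : set T) (fUV : forall x, U x -> V (f x)).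

Definition restr_fun (x : subsp U) : subsp V :=
  exist _ (f (set_val x)) (mem_set (fUV (set_valP x))).

Fact restr_continuous : continuous restr_fun.
Proof.
apply: (@continuous_comp_initial _ _ _ set_val restr_fun) => x.
apply: (@continuous_comp (subsp U) S T set_val f); last exact: cts_fun.
exact: initial_continuous.
Qed.

Definition restr : continuousType (subsp U) (subsp V) :=
  mkcts restr_continuous.

End Restriction.

Record pairmap (S T : topologicalType) (A : set S) (B : set T) := PairMap {
  pm_fun :> continuousType S T;
  pm_sub : forall x, A x -> B (pm_fun x) }.

Section PairMaps.
Variables (S T : topologicalType) (A : set S) (B : set T).

Definition pairmap_id : pairmap A A := @PairMap S S A A idfun (fun _ => id).

Definition pairmap_restr (f : pairmap A B) (U : set S) (V : set T)
    (fUV : forall x, U x -> V (f x)) :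
    pairmap (set_val @^-1` A : set (subsp U))
      (set_val @^-1` B : set (subsp V)) :=
  @PairMap (subsp U) (subsp V) (set_val @^-1` A) (set_val @^-1` B) (restr fUV)
    (fun x => @pm_sub _ _ _ _ f (set_val x)).

End PairMaps.

Section Simplex.
Variable RR : realType.

Definition std_simplex n : set 'rV[RR]_n.+1 :=
  [set t | (forall i, 0 <= t 0 i) /\ \sum_i t 0 i = 1].
Arguments std_simplex : clear implicits.

Definition face_mx n (i : 'I_n.+2) (t : 'rV[RR]_n.+1) : 'rV[RR]_n.+2 :=
  \row_j (if unlift i j is Some l then t 0 l else 0).

Fact face_mx_continuous n (i : 'I_n.+2) : continuous (@face_mx n i).
Proof.
move=> t W [P tP PW].
have tF : Filter (nbhs t) := nbhs_filter t.
have tP' : nbhs t [set s | forall j, P 0 j (face_mx i s 0 j)].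
  apply: (@filter_forall _ _ (fun j s => P 0 j (face_mx i s 0 j)) _ tF) => j.
  have := tP 0 j; rewrite mxE; case E: (unlift i j) => [l|] Pj.
    apply: (@filterS _ _ tF _ _ _ (@coord_continuous RR 1 n.+1 0 l t _ Pj)).
    by move=> s /=; rewrite mxE E.
  apply: (@filterS _ _ tF setT); last exact: filterT.
  by move=> s _; rewrite mxE E; exact: nbhs_singleton Pj.
apply: (@filterS _ _ tF _ _ _ tP') => s Ps; apply: PW => a j.
by rewrite (ord1 a).
Qed.

Fact face_mx_simplex n (i : 'I_n.+2) t :
  std_simplex n t -> std_simplex n.+1 (face_mx i t).
Proof.
move=> [t0 t1]; split=> [j|]; first by rewrite mxE; case: unlift.
rewrite (bigD1_ord i) //= mxE unlift_none add0r -[RHS]t1.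
by apply: eq_bigr => l _; rewrite mxE liftK.
Qed.

(** The [i]-th face map inserts the barycentric coordinate [0] at place [i]. *)
Definition face n (i : 'I_n.+2) :
    continuousType (subsp (std_simplex n)) (subsp (std_simplex n.+1)) :=
  @restr _ _ (mkcts (@face_mx_continuous n i)) _ _ (@face_mx_simplex n i).

Definition ssimplex (T : topologicalType) n :=
  continuousType (subsp (std_simplex n)) T.

Lemma ssimplex_eq T n (s t : ssimplex T n) : s =1 t -> s = t.
Proof. by move=> st; exact/continuousEP. Qed.

Definition sface T n (i : 'I_n.+2) (s : ssimplex T n.+1) : ssimplex T n :=
  s \o face i.

Definition spush (S T : topologicalType) (f : continuousType S T) n
    (s : ssimplex S n) : ssimplex T n := f \o s.

End Simplex.

Section Cohomology.
Variables (RR : realType) (R : comNzRingType).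

(** A linear form on the free module of singular chains is the same as a
    function on singular simplices; it vanishes on the chains of [A] iff it
    vanishes on the simplices with image in [A]. *)
Definition cochain (T : topologicalType) k : Type := ssimplex RR T k -> R^o.

HB.instance Definition _ T k := GRing.Lmodule.on (cochain T k).

Lemma cochainE T k a (x y : cochain T k) s : (a *: x + y) s = a *: x s + y s.
Proof. by []. Qed.

Definition coboundary T k (phi : cochain T k) : cochain T k.+1 :=
  fun s => \sum_(i < k.+2) (- 1) ^+ i *: phi (sface i s).

Definition rel_cochain (T : topologicalType) (A : set T) k (phi : cochain T k) : Prop :=
  forall s : ssimplex RR T k, range s `<=` A -> phi s = 0.

Fact coboundary_is_linear T k : linear (@coboundary T k).
Proof.
move=> a x y; apply/funext => s; rewrite cochainE /coboundary.
rewrite scaler_sumr -big_split /=; apply: eq_bigr => i _.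
by rewrite cochainE scalerDr !scalerA [_ * a]mulrC.
Qed.

HB.instance Definition _ T k := GRing.isLinear.Build R
  (cochain T k) (cochain T k.+1) *:%R (@coboundary T k)
  (@coboundary_is_linear T k).

Lemma rel_cochain_linear (T : topologicalType) (A : set T) k a (x y : cochain T k) :
  rel_cochain A x -> rel_cochain A y -> rel_cochain A (a *: x + y).
Proof.
by move=> Ax Ay s sA; rewrite cochainE Ax // Ay // scaler0 addr0.
Qed.

Section Groups.
Variables (T : topologicalType) (A : set T) (k : nat).

Definition rel_cocycle : cochain T k -> bool :=
  fun phi => `[< rel_cochain A phi /\ coboundary phi = 0 >].

Fact rel_cocycle_closed : submod_closed rel_cocycle.
Proof.
split=> [|a x y]; first by apply/asboolP; split=> //; exact: linear0.
move=> /asboolP[xA dx] /asboolP[yA dy]; apply/asboolP; split.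
  exact: rel_cochain_linear.
by rewrite linearP /= dx dy scaler0 addr0.
Qed.

HB.instance Definition _ :=
  GRing.isSubmodClosed.Build R (cochain T k) rel_cocycle rel_cocycle_closed.

Record cocycles := Cocycle { cocycle_val :> cochain T k;
  cocycleP : rel_cocycle cocycle_val }.

HB.instance Definition _ := [isSub for cocycle_val].
HB.instance Definition _ := [Choice of cocycles by <:].
HB.instance Definition _ := [SubChoice_isSubLmodule of cocycles by <:].

End Groups.

(** Stated inside the cocycles; there are no nonzero coboundaries in degree 0,
    where the group of cochains one degree below is zero. *)
Definition rel_coboundary (T : topologicalType) (A : set T) k : cocycles A k -> bool :=
  if k is l.+1 then fun z => `[< exists2 psi : cochain T l,
      rel_cochain A psi & (z : cochain T l.+1) = coboundary psi >]
  else fun z => z == 0.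

Fact rel_coboundary_closed (T : topologicalType) (A : set T) k :
  submod_closed (@rel_coboundary T A k).
Proof.
case: k => [|k]; split=> /=.
- by apply/eqP.
- by move=> a x y /eqP -> /eqP ->; apply/eqP; rewrite scaler0 addr0.
- by apply/asboolP; exists 0; [move=> ? ? | rewrite linear0].
move=> a x y /asboolP[u Au xu] /asboolP[v Av yv]; apply/asboolP.
exists (a *: u + v); first exact: rel_cochain_linear.
by rewrite [RHS]linearP /= -xu -yv.
Qed.

HB.instance Definition _ (T : topologicalType) (A : set T) k := GRing.isSubmodClosed.Build R
  (cocycles A k) (@rel_coboundary T A k) (@rel_coboundary_closed T A k).

Definition coboundaries (T : topologicalType) (A : set T) k : submodClosed (cocycles A k) :=
  GRing.SubmodClosed.clone R (cocycles A k) (@rel_coboundary T A k) _.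

Definition cohom (T : topologicalType) (A : set T) k : lmodType R := lmod_quot (coboundaries A k).

Section Pullback.
Variables (S T : topologicalType) (A : set S) (B : set T) (f : pairmap A B).

Definition pullback k (phi : cochain T k) : cochain S k :=
  fun s => phi (spush f s).

Lemma coboundary_pullback k (phi : cochain T k) :
  coboundary (pullback phi) = pullback (coboundary phi).
Proof.
apply/funext => s; apply: eq_bigr => i _; congr (_ *: phi _).
exact: ssimplex_eq.
Qed.

Lemma rel_cochain_pullback k (phi : cochain T k) :
  rel_cochain B phi -> rel_cochain A (pullback phi).
Proof.
move=> Bphi s sA; apply: Bphi => _ [t _ <-]; apply: pm_sub.
by apply: sA; exists t.
Qed.

Fact pullback_cocycle k (z : cocycles B k) : rel_cocycle A (pullback z).
Proof.
have /asboolP[Bz dz] := cocycleP z; apply/asboolP; split.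
  exact: rel_cochain_pullback.
by rewrite coboundary_pullback dz.
Qed.

Definition cocycle_map_fun k (z : cocycles B k) : cocycles A k :=
  Cocycle (pullback_cocycle z).

Fact cocycle_map_is_linear k : linear (@cocycle_map_fun k).
Proof. by move=> a x y; exact: val_inj. Qed.

HB.instance Definition _ k := GRing.isLinear.Build R
  (cocycles B k) (cocycles A k) *:%R (@cocycle_map_fun k)
  (@cocycle_map_is_linear k).

Fact cocycle_map_coboundary k (z : cocycles B k) :
  z \in coboundaries B k -> cocycle_map_fun z \in coboundaries A k.
Proof.
rewrite /coboundaries !unfold_in; case: k z => [|k] z /=.
  by move=> /eqP ->; rewrite linear0.
move=> /asboolP[u Bu zu]; apply/asboolP.
exists (pullback u); first exact: rel_cochain_pullback.
by rewrite coboundary_pullback /= zu.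
Qed.

Definition cohom_map k : {linear cohom B k -> cohom A k} :=
  @quot_map R _ _ (coboundaries B k) (coboundaries A k) (@cocycle_map_fun k)
    (@cocycle_map_coboundary k).

Lemma cohom_mapE k (z : cocycles B k) :
  cohom_map k (lmod_class (coboundaries B k) z) =
  lmod_class (coboundaries A k) (cocycle_map_fun z).
Proof. exact: quot_mapE. Qed.

End Pullback.

Section Functoriality.
Variables (S T U : topologicalType) (A : set S) (B : set T) (C : set U).
Variables (k : nat).

Lemma cohom_map_id (f : pairmap A A) (u : cohom A k) :
  f =1 id -> cohom_map f k u = u.
Proof.
move=> f1; have [x ->] := lmod_class_surj u.
rewrite cohom_mapE; congr lmod_class.
apply/val_inj/funext => s; rewrite /= /pullback; congr (cocycle_val _ _).
by apply: ssimplex_eq => t; rewrite /= f1.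
Qed.

Lemma cohom_map_comp (f : pairmap A B) (g : pairmap B C) (h : pairmap A C)
    (u : cohom C k) :
  h =1 g \o f -> cohom_map f k (cohom_map g k u) = cohom_map h k u.
Proof.
move=> hE; have [x ->] := lmod_class_surj u.
rewrite (cohom_mapE g x) (cohom_mapE f) (cohom_mapE h); congr lmod_class.
apply/val_inj/funext => s; rewrite /= /pullback; congr (cocycle_val _ _).
by apply: ssimplex_eq => t; rewrite /= hE.
Qed.

End Functoriality.
End Cohomology.

Definition compacta (X : topologicalType) : set (set X) := [set K | compact K].
Arguments compacta : clear implicits.

Section EndCohomology.
Variables (RR : realType) (R : comNzRingType).

Section Groups.
Variables (X : topologicalType) (A : set X) (k : nat).

Definition end_pair (K : set X) : set (subsp (~` K)) := set_val @^-1` A.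

Local Arguments end_pair : clear implicits.

Definition end_pair_incl (K L : set X) (KL : K `<=` L) :
    pairmap (end_pair L) (end_pair K) :=
  pairmap_restr (f := pairmap_id A) (subsetC KL).

Definition compactum : choiceType := Choice.clone (set_type (compacta X)) _.

Definition to_compactum (K : set X) (cK : compact K) : compactum :=
  exist (fun L => L \in compacta X) K (mem_set cK).

Definition compacta_le (K L : compactum) : Prop := set_val K `<=` set_val L.

Fact compacta_directed (K L : compactum) :
  exists M, compacta_le K M /\ compacta_le L M.
Proof.
have cKL : compacta X (set_val K `|` set_val L).
  by apply: compactU; [exact: (set_valP K) | exact: (set_valP L)].
exists (to_compactum cKL).
by split; [exact: subsetUl | exact: subsetUr].
Qed.

Fact compacta_le_refl (K : compactum) : compacta_le K K.
Proof. by []. Qed.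

Fact compacta_le_trans (K L M : compactum) :
  compacta_le K L -> compacta_le L M -> compacta_le K M.
Proof. exact: subset_trans. Qed.

Fact end_pair_incl_id (K : compactum) (KK : compacta_le K K)
    (u : cohom RR R (end_pair (set_val K)) k) :
  cohom_map RR R (end_pair_incl KK) k u = u.
Proof. by apply: cohom_map_id => x; exact: val_inj. Qed.

Fact end_pair_incl_comp (K L M : compactum) (KL : compacta_le K L)
    (LM : compacta_le L M) (KM : compacta_le K M)
    (u : cohom RR R (end_pair (set_val K)) k) :
  cohom_map RR R (end_pair_incl LM) k (cohom_map RR R (end_pair_incl KL) k u) =
  cohom_map RR R (end_pair_incl KM) k u.
Proof. by apply: cohom_map_comp => x; exact: val_inj. Qed.

Definition end_system : dirsys R :=
  @DirSys R compactum compacta_le compacta_le_refl compacta_le_trans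
    (to_compactum (@compact0 X)) compacta_directed
    (fun K => cohom RR R (end_pair (set_val K)) k)
    (fun K L KL => cohom_map RR R (end_pair_incl KL) k)
    end_pair_incl_id end_pair_incl_comp.

Definition end_cohom : lmodType R := dirlim end_system.

End Groups.

Arguments end_pair {X} A K.

Definition proper_map (Y X : topologicalType) (f : Y -> X) : Prop :=
  forall K : set X, compact K -> compact (f @^-1` K).

Record proper_pairmap (Y X : topologicalType) (B : set Y) (A : set X) :=
  ProperPairMap {
    ppm_map :> pairmap B A;
    ppm_proper : proper_map ppm_map }.
Arguments ppm_proper {Y X B A} f [K] _ : rename.

Section Map.
Variables (Y X : topologicalType) (B : set Y) (A : set X).
Variables (f : proper_pairmap B A) (k : nat).

Definition compacta_preimage (K : compactum X) : compactum Y :=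
  to_compactum (ppm_proper f (set_valP K)).

Definition end_pair_map (K : set X) :
    pairmap (end_pair B (f @^-1` K)) (end_pair A K) :=
  pairmap_restr (f := f) (fun x => id).

Fact compacta_preimage_mono (K L : compactum X) :
  compacta_le K L -> compacta_le (compacta_preimage K) (compacta_preimage L).
Proof. by move=> KL x; exact: KL. Qed.

Fact end_pair_map_nat (K L : compactum X) (KL : compacta_le K L)
    (KL' : compacta_le (compacta_preimage K) (compacta_preimage L))
    (u : cohom RR R (end_pair A (set_val K)) k) :
  cohom_map RR R (end_pair_map (set_val L)) k
    (cohom_map RR R (end_pair_incl A KL) k u) =
  cohom_map RR R (end_pair_incl B KL') k
    (cohom_map RR R (end_pair_map (set_val K)) k u).
Proof.
pose g := pairmap_restr (f := f) (U := ~` (f @^-1` set_val L))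
  (V := ~` set_val K) (fun x nLx Kx => nLx (KL _ Kx)).
transitivity (cohom_map RR R g k u); last symmetry;
  by apply: cohom_map_comp => x; exact: val_inj.
Qed.

Definition end_system_mor : dirsys_mor (end_system A k) (end_system B k) :=
  @DirsysMor R (end_system A k) (end_system B k) compacta_preimage
    compacta_preimage_mono
    (fun K => cohom_map RR R (end_pair_map (set_val K)) k)
    end_pair_map_nat.

Definition end_cohom_map : {linear end_cohom A k -> end_cohom B k} :=
  dirlim_map end_system_mor.

End Map.
End EndCohomology.

Definition locally_connected (X : topologicalType) : Prop :=
  forall (x : X) (U : set X), nbhs x U ->
    exists V : set X, [/\ open V, connected V, V x & V `<=` U].

Definition sigma_compact (X : topologicalType) : Prop :=
  exists K : nat -> set X, (forall n, compact (K n)) /\ \bigcup_n K n = setT.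

Definition metrizable (RR : realType) (X : topologicalType) : Prop :=
  exists d : X -> X -> RR,
    [/\ (forall x y, 0 <= d x y) /\ (forall x y, d x y = 0 <-> x = y),
        forall x y, d x y = d y x,
        forall x y z, d x z <= d x y + d y z &
        forall (x : X) (U : set X),
          nbhs x U <-> exists2 e, 0 < e & [set y | d x y < e] `<=` U].

Record generalized_continuum (X : topologicalType) : Prop := {
  gc_hausdorff : hausdorff_space X;
  gc_connected : connected [set: X];
  gc_locally_connected : locally_connected X;
  gc_sigma_compact : sigma_compact X;
  gc_locally_compact : locally_compact [set: X] }.

Definition embedding (S T : topologicalType) (f : S -> T) : Prop :=
  [/\ continuous f, injective f &
      forall U : set S, open U -> exists2 V : set T, open V & U = f @^-1` V].

Definition halfline (RR : realType) : topologicalType :=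
  subsp [set x : RR | 0 <= x].

Definition baseray (RR : realType) (X : topologicalType)
    (r : halfline RR -> X) : Prop := proper_map r /\ embedding r.

Record ray_based (RR : realType) := RayBased {
  rb_space :> topologicalType;
  rb_continuum : generalized_continuum rb_space;
  rb_metrizable : metrizable RR rb_space;
  rb_ray : halfline RR -> rb_space;
  rb_baseray : baseray rb_ray }.

Record ray_map (RR : realType) (Y X : ray_based RR) := RayMap {
  rm_map :> continuousType Y X;
  rm_proper : proper_map rm_map;
  rm_ray : rb_ray X = rm_map \o rb_ray Y }.
Arguments rm_proper {RR Y X} f : rename.

Section RayMaps.
Variables (RR : realType) (Y X : ray_based RR) (f : ray_map Y X).

Definition ray_map_abs : proper_pairmap (set0 : set Y) (set0 : set X) :=
  ProperPairMap (ppm_map := @PairMap Y X set0 set0 f (fun _ => id))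
    (rm_proper f).

Fact ray_map_range (y : Y) : range (rb_ray Y) y -> range (rb_ray X) (f y).
Proof. by move=> [t _ <-]; exists t => //; rewrite (rm_ray f). Qed.

Definition ray_map_rel : proper_pairmap (range (rb_ray Y)) (range (rb_ray X)) :=
  ProperPairMap (ppm_map := PairMap ray_map_range) (rm_proper f).

End RayMaps.

Section RayCohomology.
Variables (RR : realType) (R : comNzRingType).

(** [He] is absolute end cohomology, that is, relative to the empty set, and
    [rHe] is reduced end cohomology, that is, relative to the baseray. *)
Definition He (X : topologicalType) k : lmodType R :=
  end_cohom RR R (set0 : set X) k.

Definition rHe (X : ray_based RR) k : lmodType R :=
  end_cohom RR R (range (rb_ray X)) k.

Definition He_map (Y X : ray_based RR) (f : ray_map Y X) k :
    {linear He X k -> He Y k} :=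
  end_cohom_map RR R (ray_map_abs f) k.

Definition rHe_map (Y X : ray_based RR) (f : ray_map Y X) k :
    {linear rHe X k -> rHe Y k} :=
  end_cohom_map RR R (ray_map_rel f) k.

End RayCohomology.

(* Main.v *)
(** A ray-based space and its baseray are compared at a cofinal family of
    compacta: [K] is enlarged by an initial segment of the ray, so that the ray
    meets the complement in a tail, homeomorphic to a convex subset [C] of the
    line.  Coning off simplices of [C] shows that its cohomology is that of a
    point.  Hence, for such [K], the map from the cohomology relative to the ray
    to the absolute cohomology is injective, is onto in positive degrees, and in
    degree 0 has the constant functions as a complement of its image.  Passing
    to the limit, end cohomology is reduced end cohomology plus the constant
    classes in degree 0.  The same argument for the identity ray of the half
    line, whose reduced end cohomology vanishes, shows that the constants are
    exactly the end cohomology of the half line.  Constants are preserved by all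
    proper maps, which makes the splitting natural. *)
Require Import Defs.
From HB Require Import structures.
From mathcomp Require Import all_boot all_order all_algebra.
From mathcomp Require Import all_classical all_reals all_analysis.
From mathcomp Require Import ring lra zify.

Set Implicit Arguments.
Unset Strict Implicit.
Unset Printing Implicit Defensive.

Import Order.TTheory GRing.Theory Num.Theory.
Import numFieldNormedType.Exports.

Local Open Scope classical_set_scope.
Local Open Scope ring_scope.

Definition in_subsp (T : topologicalType) (A : set T) (x : T) (Ax : A x) :
    subsp A := exist (fun y => y \in A) x (mem_set Ax).

Lemma valL_subsp (T : topologicalType) (A : set T) (U : Type) (v : U)
    (f : subsp A -> U) (x : subsp A) : 'valL_v f (set_val x) = f x.
Proof. exact: (congr1 (@^~ x) (valLK v f)). Qed.

(** * Convex sets of reals have the cohomology of a point *)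

Section Cone.
Variable RR : realType.

(** The coordinates off vertex [0]; divided by [1 - t 0 0] they give the projection of [t] from that
    vertex to the opposite face. *)
Definition barytail n (t : 'rV[RR]_n.+2) : 'rV[RR]_n.+1 :=
  \row_j t 0 (lift ord0 j).

Lemma std_simplex_le1 n (t : 'rV[RR]_n.+1) i : std_simplex t -> t 0 i <= 1.
Proof.
move=> [t0 <-]; rewrite (bigD1 i) //= lerDl.
by apply: sumr_ge0 => j _; exact: t0.
Qed.

Lemma std_simplex_bounded n : bounded_set (@std_simplex RR n).
Proof.
exists 1; split=> [//|M M1 t Dt].
rewrite /Num.norm /= mx_normrE; apply/bigmax_leP; split=> [|[i j] _ /=].
  by rewrite (le_trans _ (ltW M1)).
rewrite (ord1 i) ger0_norm; last by case: Dt.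
by rewrite (le_trans _ (ltW M1)) ?std_simplex_le1.
Qed.

Lemma std_simplex_closed n : closed (@std_simplex RR n).
Proof.
have -> : @std_simplex RR n =
    (\bigcap_i [set t : 'rV[RR]_n.+1 | 0 <= t 0 i]) `&`
    [set t : 'rV[RR]_n.+1 | \sum_i t 0 i = 1].
  apply/seteqP; split=> t [t0 t1]; split=> // i; last exact: t0.
  by move=> _; exact: t0.
apply: closedI.
  apply: closed_bigI => i _.
  apply: (@preimage_closed _ _ (fun t : 'rV[RR]_n.+1 => t 0 i)
    [set x | 0 <= x]) => //.
    by move=> t _; exact: coord_continuous.
apply: (@preimage_closed _ _ (fun t : 'rV[RR]_n.+1 => \sum_i t 0 i)
  [set x | x = 1]) => //.
  move=> t _; have tF : Filter (nbhs t) := nbhs_filter t.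
  apply: cvg_big => //; first exact: add_continuous.
  by move=> i _; exact: coord_continuous.

Qed.

Lemma std_simplex_compact n : compact (@std_simplex RR n).
Proof.
apply: bounded_closed_compact;
  [exact: std_simplex_bounded|exact: std_simplex_closed].
Qed.

(** Compactness of the simplex. The bound controls a cone near its apex, where the projection to the
    base is undefined. *)
Lemma simplex_fun_bounded n (s : subsp (@std_simplex RR n) -> RR) :
  continuous s -> exists2 M : RR, 0 <= M & forall t, `|s t| <= M.
Proof.
move=> /subspace_valL_continuousP' - /(_ 0) /continuous_compact.
move=> /(_ (@std_simplex_compact n)) /compact_bounded [M [Mr sM]].
(* Only numbers strictly above [M] are known to be bounds; the maximum with [0] makes the chosen one
   nonnegative. *)
have M1 : M < Num.max 0 (M + 1) by rewrite lt_max ltrDl ltr01 orbT.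
exists (Num.max 0 (M + 1)) => [|t]; first by rewrite le_max lexx.
apply: (sM _ M1); exists (set_val t); first exact: set_valP.
exact: valL_subsp.
Qed.

Lemma barytail_simplex n (t : 'rV[RR]_n.+2) : std_simplex t -> t 0 0 != 1 ->
  std_simplex ((1 - t 0 0)^-1 *: barytail t).
Proof.
move=> Dt t01; have t0le : t 0 0 <= 1 by exact: std_simplex_le1.
have [t0 t1] := Dt; split=> [i|].
  by rewrite !mxE mulr_ge0 ?invr_ge0 ?subr_ge0.
under eq_bigr do rewrite !mxE.
rewrite -mulr_sumr; have <- : 1 - t 0 0 = \sum_(j < n.+1) t 0 (lift ord0 j).
  by rewrite -t1 big_ord_recl /= [LHS]addrAC subrr add0r.
by rewrite mulVf // subr_eq0 eq_sym.
Qed.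

Lemma barytail_continuous n : continuous (@barytail n).
Proof.
move=> t W [P tP PW].
have tF : Filter (nbhs t) := nbhs_filter t.
have tP' : nbhs t [set s | forall j, P 0 j (barytail s 0 j)].
  apply: (@filter_forall _ _ (fun j s => P 0 j (barytail s 0 j)) _ tF) => j.
  have := tP 0 j; rewrite mxE => Pj.
  apply: (@filterS _ _ tF _ _ _ (@coord_continuous RR 1 n.+2 0 _ t _ Pj)).
  by move=> s /=; rewrite mxE.
apply: (@filterS _ _ tF _ _ _ tP') => s Ps; apply: PW => a j.
by rewrite (ord1 a).
Qed.

Lemma barytail_face0 n (t : 'rV[RR]_n.+1) : barytail (face_mx 0 t) = t.
Proof. by apply/rowP => j; rewrite !mxE liftK. Qed.

Lemma face_mx_lift0 n (i : 'I_n.+2) (t : 'rV[RR]_n.+2) :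
  face_mx (lift ord0 i) t 0 0 = t 0 0.
Proof.
rewrite !mxE; case: unliftP => [j|//].
case: (unliftP ord0 j) => [l ->|-> //].
by move=> /(congr1 val); rewrite /= /bump /= !add1n addnS.
Qed.

(** Faces other than face [0] contain the apex, vertex [0], and act on the remaining coordinates as
    faces of the base. *)
Lemma barytail_face n (i : 'I_n.+2) (t : 'rV[RR]_n.+2) :
  barytail (face_mx (lift ord0 i) t) = face_mx i (barytail t).
Proof.
apply/rowP => j; rewrite !mxE; case: (unliftP i j) => [l ->|->].
  have -> : lift ord0 (lift i l) = lift (lift ord0 i) (lift ord0 l).
    by apply: val_inj; rewrite /= /bump /= !add1n !addnS ltnS.
  by rewrite liftK mxE.
by rewrite unlift_none.
Qed.

Lemma face_mxZ n (i : 'I_n.+2) a (t : 'rV[RR]_n.+1) :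
  face_mx i (a *: t) = a *: face_mx i t.
Proof.
by apply/rowP => j; rewrite !mxE; case: unlift => [l|]; rewrite ?mxE ?mulr0.
Qed.

(** At the apex, where [1 - t0] vanishes, the argument of [s] is a junk value
    but its coefficient is [0]. *)
Definition cone_fun n (p : RR) (s : subsp (@std_simplex RR n) -> RR)
    (t : subsp (@std_simplex RR n.+1)) : RR :=
  let t0 := set_val t 0 0 in
  t0 * p + (1 - t0) * 'valL_0 s ((1 - t0)^-1 *: barytail (set_val t)).

(** Off the apex the projection to the base is continuous; at the apex [s] stays bounded while its
    coefficient tends to [0]. *)
Lemma cone_fun_continuous n p (s : subsp (@std_simplex RR n) -> RR) :
  continuous s -> continuous (cone_fun p s).
Proof.
move=> cs t; have tF : Filter (nbhs t) := nbhs_filter t.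
have valt : set_val @ t --> set_val t by exact: initial_continuous.
have coord0 : (fun u : subsp (@std_simplex RR n.+1) => set_val u 0 0)
    @ t --> set_val t 0 0.
  apply: (@continuous_comp _ _ _ set_val (fun u : 'rV_n.+2 => u 0 0)) => //.
  exact: coord_continuous.
have [t01|t01] := eqVneq (set_val t 0 0) 1.
  have [M M0 sM] := simplex_fun_bounded cs.
  (* Bounds [p - v] for every value [v] of the extended [s]; the summand [1] makes it a positive
     divisor. *)
  have Mp : 0 < `|p| + M + 1 by rewrite ltr_wpDl ?addr_ge0.
  rewrite /continuous_at /cone_fun /= t01 subrr mul1r mul0r addr0.
  apply/cvgrPdist_lt => e e0.
  have : nbhs t [set u : subsp (@std_simplex RR n.+1) |
      `|1 - set_val u 0 0| < e / (`|p| + M + 1)].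
    move: coord0; rewrite t01 => /cvgrPdist_lt; apply; exact: divr_gt0.
  apply: filterS => u /=; rewrite ltr_pdivlMr // => u1; apply: le_lt_trans u1.
  set a := set_val u 0 0; set v := oapp s 0 _.
  have -> : p - (a * p + (1 - a) * v) = (1 - a) * (p - v) by ring.
  rewrite normrM ler_wpM2l // (le_trans (ler_normB _ _)) // -addrA lerD2l.
  have vM : `|v| <= M.
    by rewrite /v; case: ('oinv_set_val _) => [x|] //=; rewrite normr0.
  by rewrite (le_trans vM) // lerDl.
(* Continuity of the extension of [s] by [0] holds relative to the simplex, so the projection must
   converge in the filter [within] it. *)
have cn : (fun u : subsp (@std_simplex RR n.+1) =>
    (1 - set_val u 0 0)^-1 *: barytail (set_val u)) @ t -->
    within (@std_simplex RR n)
      (nbhs ((1 - set_val t 0 0)^-1 *: barytail (set_val t))).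
  have coordB : (fun u : subsp (@std_simplex RR n.+1) => 1 - set_val u 0 0)
      @ t --> 1 - set_val t 0 0 by apply: cvgB => //; exact: cvg_cst.
  have tB : 1 - set_val t 0 0 != 0 by rewrite subr_eq0 eq_sym.
  have cZ : (fun u : subsp (@std_simplex RR n.+1) =>
    (1 - set_val u 0 0)^-1 *: barytail (set_val u)) @ t -->
    (1 - set_val t 0 0)^-1 *: barytail (set_val t).
    apply: cvgZ; first exact: cvgV.
    apply: (@continuous_comp _ _ _ set_val (@barytail n)) => //.
    exact: barytail_continuous.
  move=> W /cZ W1; have : nbhs t
      [set u : subsp (@std_simplex RR n.+1) | 1 - set_val u 0 0 != 0].
    by have := @cvgr_neq0 _ RR _ _ _ _ _ coordB tB; apply.
  move=> nz; apply: (@filterS2 _ (nbhs t) tF _ _ _ _ W1 nz) => u /= Wu u1.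
  apply: Wu.
  apply: barytail_simplex; first exact: set_valP.
  by rewrite eq_sym -subr_eq0.
rewrite /continuous_at /cone_fun /=.
apply: cvgD; first by apply: cvgM => //; exact: cvg_cst.
apply: cvgM; first by apply: cvgB => //; exact: cvg_cst.
move/subspace_valL_continuousP' : cs => /(_ 0)/subspace_continuousP.
move=> /(_ _ (barytail_simplex (set_valP t) t01)).
exact: cvg_comp cn.
Qed.

Lemma cone_fun_face0 n p (s : subsp (@std_simplex RR n) -> RR) t :
  cone_fun p s (face RR ord0 t) = s t.
Proof.
rewrite /cone_fun.
have -> : set_val (face RR ord0 t) = face_mx 0 (set_val t) by [].
rewrite barytail_face0 mxE unlift_none subr0 invr1 scale1r mul0r add0r mul1r.
exact: valL_subsp.
Qed.

Lemma cone_fun_face n p (s : subsp (@std_simplex RR n.+1) -> RR) (i : 'I_n.+2)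
    (t : subsp (@std_simplex RR n.+1)) :
  cone_fun p s (face RR (lift ord0 i) t) = cone_fun p (s \o face RR i) t.
Proof.
rewrite /cone_fun.
have -> : set_val (face RR (lift ord0 i) t) =
  face_mx (lift ord0 i) (set_val t) by [].
rewrite barytail_face face_mx_lift0 -face_mxZ.
(* At the apex the projection is junk on both sides, but multiplied by [0]. *)
have [->|t01] := eqVneq (set_val t 0 0) 1; first by rewrite subrr !mul0r.
congr (_ + _ * _).
have Dt := barytail_simplex (set_valP t) t01.
pose u : subsp (@std_simplex RR n) := in_subsp Dt.
have -> : (1 - set_val t 0 0)^-1 *: barytail (set_val t) = set_val u by [].
rewrite [RHS]valL_subsp.
exact: (valL_subsp 0 s (face RR i u)).
Qed.

(** A cone on a point is a segment, whose face opposite the base is the apex. *)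
Lemma cone_fun_face1 p (s : subsp (@std_simplex RR 0) -> RR)
    (t : subsp (@std_simplex RR 0)) :
  cone_fun p s (face RR (lift ord0 ord0) t) = p.
Proof.
rewrite /cone_fun.
have -> : set_val (face RR (lift ord0 ord0) t) =
  face_mx (lift ord0 ord0) (set_val t) by [].
have [_] := set_valP t; rewrite big_ord_recl big_ord0 addr0 => t1.
rewrite mxE; case: unliftP => [j|/(congr1 val) //].
by rewrite (ord1 j) t1 subrr mul0r addr0 mul1r.
Qed.

End Cone.

Section ConvexSet.
Variables (RR : realType) (C : set RR).
Hypothesis convC : forall x y a : RR, C x -> C y -> 0 <= a <= 1 ->
  C (a * x + (1 - a) * y).

Section ConeSimplex.
Variables (p : subsp C) (n : nat) (s : ssimplex RR (subsp C) n).

Fact cone_fun_in t : C (cone_fun (set_val p) (set_val \o s) t).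
Proof.
rewrite /cone_fun; have Dt := set_valP t; have [t0 _] := Dt.
have [->|t01] := eqVneq (set_val t 0 0) 1.
  by rewrite subrr mul0r addr0 mul1r; exact: set_valP.
apply: convC; first exact: set_valP; last first.
  by rewrite t0 (std_simplex_le1 _ Dt).
pose u : subsp (@std_simplex RR n) :=
  in_subsp (barytail_simplex Dt t01).
have -> : (1 - set_val t 0 0)^-1 *: barytail (set_val t) = set_val u by [].
by rewrite valL_subsp; exact: set_valP.
Qed.

Definition cone_simplex_fun t : subsp C := in_subsp (cone_fun_in t).

Fact cone_simplex_continuous : continuous cone_simplex_fun.
Proof.
apply: (@continuous_comp_initial _ _ _ set_val cone_simplex_fun).
apply: cone_fun_continuous => t.
apply: (@continuous_comp _ _ _ s set_val); first exact: cts_fun.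
exact: initial_continuous.
Qed.

Definition cone_simplex : ssimplex RR (subsp C) n.+1 :=
  mkcts cone_simplex_continuous.

End ConeSimplex.

Lemma sface_cone0 p n (s : ssimplex RR (subsp C) n) :
  sface ord0 (cone_simplex p s) = s.
Proof. by apply: ssimplex_eq => t; apply: val_inj; exact: cone_fun_face0. Qed.

Lemma sface_cone p n (s : ssimplex RR (subsp C) n.+1) i :
  sface (lift ord0 i) (cone_simplex p s) = cone_simplex p (sface i s).
Proof. by apply: ssimplex_eq => t; apply: val_inj; exact: cone_fun_face. Qed.

Lemma sface_cone1 p (s : ssimplex RR (subsp C) 0) :
  sface (lift ord0 ord0) (cone_simplex p s) = cst p.
Proof. by apply: ssimplex_eq => t; apply: val_inj; exact: cone_fun_face1. Qed.

Variable R : comNzRingType.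

(** Coning is a contracting homotopy: the boundary of the cone on [s] is [s] minus the cone on the
    boundary of [s]. Hence evaluating [phi] on cones gives a primitive. *)
Lemma convex_cocycle n (phi : cochain RR R (subsp C) n.+1) (p : subsp C) :
  coboundary phi = 0 -> exists psi, phi = coboundary psi.
Proof.
move=> dphi; exists (fun s => phi (cone_simplex p s)); apply/funext => s.
have := congr1 (@^~ (cone_simplex p s)) dphi.
rewrite /coboundary big_ord_recl expr0 scale1r sface_cone0 => /eqP.
rewrite addr_eq0 => /eqP ->; rewrite -sumrN; apply: eq_bigr => i _.
by rewrite sface_cone lift0 exprS mulN1r scaleNr opprK.
Qed.

(** The cone on a point is a path to [p], and a cocycle of degree [0] agrees at both ends of a
    path. *)
Lemma convex_cocycle0 (phi : cochain RR R (subsp C) 0) (p : subsp C) s :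
  coboundary phi = 0 -> phi s = phi (cst p).
Proof.
move=> dphi; have := congr1 (@^~ (cone_simplex p s)) dphi.
rewrite /coboundary big_ord_recl expr0 scale1r sface_cone0.
rewrite big_ord_recl big_ord0 addr0 sface_cone1 expr1 scaleN1r => /eqP.
by rewrite subr_eq0 => /eqP.
Qed.

End ConvexSet.


(** * Simplicial identities and the square of the coboundary *)

Lemma face_mx_comm (RR : realType) n (i j' : 'I_n.+3) (i' j : 'I_n.+2)
    (t : 'rV[RR]_n.+1) : i = i'.+1 :> nat -> j' = j :> nat -> (j <= i')%N ->
  face_mx i (face_mx j t) = face_mx j' (face_mx i' t).
Proof.
move=> ii' jj' ji; have liftE a b : val (lift a b) = bump (val a) b by [].
apply/rowP => m; rewrite !mxE; case: (unliftP i m) => [a ->|->]; last first.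
  have -> : i = lift j' i' by apply: val_inj; rewrite liftE /= /bump jj' ji.
  by rewrite liftK mxE unlift_none.
rewrite mxE; case: (unliftP j a) => [b ->|->]; last first.
  have -> : lift i j = j'.
    by apply: val_inj; rewrite liftE /= /bump ii' jj' leqNgt ltnS ji.
  by rewrite unlift_none.
have -> : lift i (lift j b) = lift j' (lift i' b).
  by apply: val_inj; rewrite !liftE /= ii' jj' /bump; lia.
by rewrite liftK mxE liftK.
Qed.

(** The ordinals on the two sides have different bounds, so the simplicial identity relates them
    through their values. *)
Lemma sface_comm (RR : realType) (T : topologicalType) n (i j' : 'I_n.+3)
    (i' j : 'I_n.+2) (s : ssimplex RR T n.+2) :
  i = i'.+1 :> nat -> j' = j :> nat -> (j <= i')%N ->
  sface j (sface i s) = sface i' (sface j' s).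
Proof.
move=> ii' jj' ji; apply: ssimplex_eq => t /=; congr (s _).
apply: val_inj; exact: face_mx_comm.
Qed.

(** The alternating sum of a family satisfying the simplicial identities
    [d_j d_(i+1) = d_i d_j], [j <= i]: the terms with [j < i] cancel those with
    [j >= i]. *)
Lemma alternating_sum_comm (R : pzRingType) (V : lmodType R) n
    (G : nat -> nat -> V) :
  (forall i j, (j <= i < n)%N -> G i.+1 j = G j i) ->
  \sum_(i < n.+1) \sum_(j < n) (- 1) ^+ (i + j) *: G i j = 0.
Proof.
move=> Gcomm; pose F i j := (- 1) ^+ (i + j) *: G i j.
transitivity (\sum_(i < n.+1) ((\sum_(j < n | (j < i)%N) F i j) +
                                \sum_(j < n | ~~ (j < i)%N) F i j)).
  by apply: eq_bigr => i _; rewrite (bigID (fun j : 'I_n => (j < i)%N)).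
(* The row [i = 0] has no [j < i] and the row [i = n] has no [j >= i]; dropping them and shifting
   the first sum puts both over [i < n]. *)
rewrite big_split /= big_ord_recl big_pred0_eq add0r.
rewrite [X in _ + X]big_ord_recr /= [X in _ + (_ + X)]big1 ?addr0 => [|j]; last first.
  by rewrite ltn_ord.
rewrite (eq_bigr (fun i : 'I_n => \sum_(j < n | (j <= i)%N) F i.+1 j)) //.
rewrite (exchange_big_dep predT) //= -big_split big1 //= => j _.
rewrite (eq_bigl (fun i : 'I_n => ~~ (i < j)%N)) => [|i]; last by rewrite -leqNgt.
rewrite -big_split big1 //= => i; rewrite -leqNgt => ji.
rewrite /F Gcomm ?ji ?ltn_ord //.
by rewrite addSn exprS mulN1r scaleNr addnC addNr.
Qed.

Lemma coboundary_coboundary (RR : realType) (R : comNzRingType)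
    (T : topologicalType) k (phi : cochain RR R T k) :
  coboundary (coboundary phi) = 0.
Proof.
apply/funext => s; rewrite /coboundary.
(* [inord] extends the double faces to all pairs of naturals, as the alternating sum requires. *)
pose G i j := phi (sface (inord j) (sface (inord i) s)).
rewrite -[RHS](@alternating_sum_comm R _ k.+2 G) => [|i j /andP[ji ik]].
  apply: eq_bigr => i _; rewrite scaler_sumr; apply: eq_bigr => j _.
  by rewrite scalerA exprD /G !inord_val.
rewrite /G; congr phi; apply: sface_comm; rewrite !inordK //; lia.
Qed.

(** * Pairs whose subspace is a convex set of reals *)

(** The pointwise lift is continuous because each open set of [S] is the preimage under [q] of an
    open set of [T]. *)
Lemma embedding_lift (S T W : topologicalType) (q : S -> T) (f : W -> T) :
  embedding q -> continuous f -> range f `<=` range q ->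
  exists g : continuousType W S, f = q \o g.
Proof.
move=> [_ qinj qopen] cf fq.
have /choice [g gE] : forall w, exists x, q x = f w.
  by move=> w; have [x _ <-] := fq _ (imageT f w); exists x.
have cg : continuous g.
  apply/continuousP => U /qopen [V oV ->].
  rewrite -comp_preimage (_ : q \o g = f); last exact/funext.
  by move/continuousP : cf; exact.
by exists (mkcts cg); apply/funext => w; rewrite /= gE.
Qed.

Fact vertex_subproof (RR : realType) n :
  std_simplex (delta_mx 0 ord0 : 'rV[RR]_n.+1).
Proof.
split=> [i|]; first by rewrite mxE; case: (_ && _).
rewrite (bigD1 ord0) //= mxE !eqxx big1 ?addr0 // => i /negPf i0.
by rewrite mxE i0 andbF.
Qed.

Definition vertex (RR : realType) n : subsp (@std_simplex RR n) :=
  in_subsp (vertex_subproof RR n).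

(** A simplex has a point, for instance a vertex, so none maps into an empty subspace. *)
Lemma rel_cochain_empty (RR : realType) (R : comNzRingType)
    (T : topologicalType) (B : set T) k (phi : cochain RR R T k) :
  (forall x, ~ B x) -> rel_cochain B phi.
Proof.
move=> B0 s sB; case: (B0 (s (vertex RR k))).
by apply: sB; exists (vertex RR k).
Qed.

(** * Constant classes in degree 0 *)

Section ConstantClass.
Variables (RR : realType) (R : comNzRingType) (T : topologicalType).

Lemma coboundary_cst a : coboundary (cst a : cochain RR R T 0) = 0.
Proof.
apply/funext => s; rewrite /coboundary !big_ord_recl big_ord0 addr0.
by rewrite expr0 scale1r expr1 scaleN1r subrr.
Qed.

Variables (B : set T) (B0 : forall x, ~ B x).

Fact cst_cocycle a : rel_cocycle B (cst a : cochain RR R T 0).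
Proof.
apply/asboolP; split; first exact: rel_cochain_empty.
exact: coboundary_cst.
Qed.

Definition cst_class a : cohom RR R B 0 :=
  lmod_class (coboundaries RR R B 0) (Cocycle (cst_cocycle a)).

Fact cst_class_is_linear : linear (cst_class : R^o -> _).
Proof.
by move=> a x y; rewrite /cst_class -linearP; congr lmod_class; exact: val_inj.
Qed.

End ConstantClass.

Lemma cohom_map_cst (RR : realType) (R : comNzRingType) (S T : topologicalType)
    (A : set S) (B : set T) (A0 : forall x, ~ A x) (B0 : forall x, ~ B x)
    (f : Defs.pairmap A B) (a : R) :
  cohom_map RR R f 0 (cst_class RR B0 a) = cst_class RR A0 a.
Proof.
by rewrite /cst_class cohom_mapE; congr lmod_class; exact: val_inj.
Qed.

Lemma coboundary_cocycle (RR : realType) (R : comNzRingType)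
    (T : topologicalType) (A : set T) k (z : cocycles RR R A k) :
  coboundary z = 0.
Proof. by have /asboolP[] := cocycleP z. Qed.

Section ConvexPair.
Variables (RR : realType) (R : comNzRingType) (C : set RR).
Hypothesis convC : forall x y a : RR, C x -> C y -> 0 <= a <= 1 ->
  C (a * x + (1 - a) * y).
Variables (T : topologicalType) (q : continuousType (subsp C) T).
Hypothesis qemb : embedding q.

Let qpair : Defs.pairmap [set: subsp C] (range q) :=
  @PairMap _ _ setT (range q) q (fun x _ => imageT q x).

(** Simplices in the range lift through the embedding, so the values of [phi] on them are values of
    its pullback. *)
Lemma rel_cochain_range k (phi : cochain RR R T k) :
  pullback qpair phi = 0 -> rel_cochain (range q) phi.
Proof.
move=> phi0 s sq; have [g sE] := embedding_lift qemb (@cts_fun _ _ s) sq.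
rewrite (_ : s = spush qpair g); first exact: (congr1 (@^~ g) phi0).
by apply: ssimplex_eq => t; rewrite sE.
Qed.

Lemma range_cocycle k (phi : cochain RR R T k) :
  rel_cochain (range q) (coboundary phi) -> coboundary (pullback qpair phi) = 0.
Proof.
move=> dphi; rewrite coboundary_pullback; apply/funext => s; apply: dphi.
by move=> _ [t _ <-]; exists (s t).
Qed.

(** Extension by zero: as [q] is injective, a simplex factors through it in at most one way. *)
Lemma cochain_extension k (psi : cochain RR R (subsp C) k) :
  exists chi : cochain RR R T k, pullback qpair chi = psi.
Proof.
exists (fun s => if pselect (exists g, s = spush q g) is left e
  then psi (projT1 (cid e)) else 0).
apply/funext => s; rewrite /pullback; case: pselect => [e|]; last first.
  by case; exists s.
case: cid => g /= sg; congr psi; apply: ssimplex_eq => t.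
have [_ qinj _] := qemb; apply: qinj.
exact: (esym (congr1 (fun h : ssimplex RR T k => h t) sg)).
Qed.

(** A primitive over [C], extended to [T]. Constraining the coboundary on the range alone covers
    both absolute cocycles and primitives of relative ones. *)
Lemma range_exact k (p : subsp C) (phi : cochain RR R T k.+1) :
  rel_cochain (range q) (coboundary phi) ->
  exists chi, rel_cochain (range q) (phi - coboundary chi).
Proof.
move=> /range_cocycle /(convex_cocycle convC p) [psi phiE].
have [chi chiE] := cochain_extension psi.
exists chi; apply: rel_cochain_range; apply/funext => s.
have := congr1 (@^~ s) phiE; rewrite -chiE coboundary_pullback /pullback => e.
by rewrite /GRing.add /= e addrN.
Qed.

Lemma range_exact0 (p : subsp C) (phi : cochain RR R T 0) :
  rel_cochain (range q) (coboundary phi) ->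
  rel_cochain (range q) (phi - cst (phi (cst (q p)))).
Proof.
move=> /range_cocycle /(convex_cocycle0 convC p) phiE.
apply: rel_cochain_range; apply/funext => s; have := phiE s.
rewrite /pullback => e.
rewrite /GRing.add /= e; apply/eqP; rewrite subr_eq0; apply/eqP; congr phi.
exact: ssimplex_eq.
Qed.

Variables (A B : set T) (pm : Defs.pairmap B A).
Hypotheses (Aq : A = range q) (B0 : forall x, ~ B x) (pmid : pm =1 id).

Lemma pullback_id k (phi : cochain RR R T k) : pullback pm phi = phi.
Proof.
apply/funext => s; rewrite /pullback; congr phi.
by apply: ssimplex_eq => t; rewrite /= pmid.
Qed.

(** A primitive of a relative cocycle is itself a cocycle on the range, so it can be made to vanish
    there without changing its coboundary. *)
Lemma convex_pair_inj k (p : subsp C) (u : cohom RR R A k) :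
  cohom_map RR R pm k u = 0 -> u = 0.
Proof.
have [z ->] := lmod_class_surj u; rewrite cohom_mapE.
rewrite -(linear0 (lmod_class (coboundaries RR R A k))).
rewrite -(linear0 (lmod_class (coboundaries RR R B k))).
move=> /lmod_classP; rewrite subr0 => zB; apply/lmod_classP; rewrite subr0.
have /asboolP[Az _] := cocycleP z.
move: zB; rewrite /coboundaries !unfold_in; case: k z Az {u} => [|k] z Az /=.
  (* Degree [0] has no nonzero coboundaries: the cocycle itself vanishes. *)
  move=> /eqP /(congr1 val) /= z0; apply/eqP; apply: val_inj.
  exact: etrans (esym (pullback_id z)) z0.
move=> /asboolP[psi _]; rewrite /= pullback_id => zE; apply/asboolP.
have dpsi : rel_cochain (range q) (coboundary psi) by rewrite -zE -Aq.
(* A primitive of degree [0] is corrected by a constant, one of higher degree by a coboundary. *)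
case: k z Az psi zE dpsi => [|k] z Az psi zE dpsi.
  exists (psi - cst (psi (cst (q p)))); first by rewrite Aq; exact: range_exact0.
  by rewrite linearB /= coboundary_cst subr0.
have [chi chiA] := range_exact p dpsi.
exists (psi - coboundary chi); first by rewrite Aq.
by rewrite linearB /= zE coboundary_coboundary subr0.
Qed.

(** An absolute cocycle has a primitive on the range; subtracting the coboundary of its extension
    gives a relative cocycle in the same absolute class. *)
Lemma convex_pair_surj k (p : subsp C) (c : cohom RR R B k.+1) :
  exists u, c = cohom_map RR R pm k.+1 u.
Proof.
have [z ->] := lmod_class_surj c.
have dz : rel_cochain (range q) (coboundary z) by rewrite coboundary_cocycle.
have [chi chiA] := range_exact p dz.
have zA : rel_cocycle A (cocycle_val z - coboundary chi).
  apply/asboolP; split; first by rewrite Aq.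
  by rewrite linearB /= coboundary_cocycle coboundary_coboundary subr0.
exists (lmod_class (coboundaries RR R A k.+1) (Cocycle zA)).
rewrite cohom_mapE; apply/lmod_classP.
rewrite /coboundaries !unfold_in /=; apply/asboolP; exists chi.
  exact: rel_cochain_empty.
rewrite /= pullback_id /=.
by rewrite opprB addrC subrK.
Qed.

(** The scalar is the value of the cocycle at the point [q p], which is its value on all of the
    range. *)
Lemma convex_pair_split0 (p : subsp C) (c : cohom RR R B 0) :
  exists u a, c = cohom_map RR R pm 0 u + cst_class RR B0 a.
Proof.
have [z ->] := lmod_class_surj c.
have dz : rel_cochain (range q) (coboundary z) by rewrite coboundary_cocycle.
pose a := cocycle_val z (cst (q p)).
have zA : rel_cocycle A (cocycle_val z - cst a).
  apply/asboolP; split; first by rewrite Aq; exact: range_exact0.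
  by rewrite linearB /= coboundary_cocycle coboundary_cst subr0.
exists (lmod_class (coboundaries RR R A 0) (Cocycle zA)), a.
rewrite cohom_mapE -linearD; congr lmod_class; apply: val_inj.
by rewrite /= pullback_id /= subrK.
Qed.

End ConvexPair.

(** * Tails of a baseray *)

Lemma embedding_comp (S T U : topologicalType) (f : S -> T) (g : T -> U) :
  embedding f -> embedding g -> embedding (g \o f).
Proof.
move=> [cf fi fo] [cg gi go]; split; last 1 first.
- move=> W /fo[V oV ->]; have [V' oV' ->] := go _ oV.
  by exists V'.
- by move=> x; apply: continuous_comp; [exact: cf|exact: cg].
- exact: inj_comp.
Qed.

Lemma in_subsp_embedding (S T : topologicalType) (f : S -> T) (V : set T)
    (fV : forall x, V (f x)) :
  embedding f -> embedding (fun x => in_subsp (fV x)).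
Proof.
move=> [cf fi fo]; split.
- exact: (@continuous_comp_initial _ _ _ set_val (fun x => in_subsp (fV x))).
- by move=> x y /(congr1 set_val); exact: fi.
move=> W /fo[V' oV' ->]; exists (set_val @^-1` V') => //.
by exists V'.
Qed.

Lemma set_val_embedding (T : topologicalType) (A : set T) :
  embedding (set_val : subsp A -> T).
Proof.
split; [exact: initial_continuous|exact: val_inj|].
by move=> U [V oV <-]; exists V.
Qed.

Section Ray.
Variables (RR : realType) (X : topologicalType) (r : halfline RR -> X).
Hypothesis hr : baseray r.

Lemma baseray_continuous : continuous r.
Proof. by case: hr => _ []. Qed.

Lemma halfline_compact_bounded (K : set (halfline RR)) : compact K ->
  exists2 N : RR, 0 <= N & forall t, K t -> set_val t <= N.
Proof.
move=> cK; have : compact (set_val @` K : set RR).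
  apply: continuous_compact => //; apply: continuous_subspaceT.
  exact: initial_continuous.
move=> /compact_bounded[M [Mr KM]].
have M1 : M < Num.max 0 (M + 1) by rewrite lt_max ltrDl ltr01 orbT.
exists (Num.max 0 (M + 1)) => [|t Kt]; first by rewrite le_max lexx.
rewrite (le_trans (ler_norm _)) //; apply: (KM _ M1).
by exists t.
Qed.

Lemma halfline_segment_compact (N : RR) :
  compact [set t : halfline RR | set_val t <= N].
Proof.
(* The absolute value maps the line continuously onto the half line and carries [[0, N]] to the
   segment. *)
pose f (x : RR) : halfline RR :=
  @in_subsp RR [set x : RR | 0 <= x] `|x| (normr_ge0 x).
have cf : continuous f.
  apply: (@continuous_comp_initial _ _ _ set_val f) => x; exact: norm_continuous.
have -> : [set t : halfline RR | set_val t <= N] = f @` `[0, N]%classic.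
  apply/seteqP; split=> [t tN|y [x /=]].
    exists (set_val t); first by rewrite /= in_itv /= (set_valP t).
    by apply: val_inj; rewrite /= ger0_norm //; exact: (set_valP t).
  rewrite in_itv /= => /andP[x0 xN] <-.
  by rewrite (_ : set_val (f x) = `|x|) // ger0_norm.
apply: continuous_compact; last exact: segment_compact.
exact: continuous_subspaceT.
Qed.

(** Properness makes the preimage of [K] under [r] compact, hence bounded by some [N]; adding
    [r([0, N])] to [K] fills the gaps below [N]. *)
Lemma ray_cofinal (K : set X) : compact K -> exists (L : set X) (N : RR),
  [/\ compact L, K `<=` L, 0 <= N & forall t, L (r t) <-> set_val t <= N].
Proof.
move=> cK; have [rp [_ rinj _]] := hr.
have [N N0 KN] := halfline_compact_bounded (rp _ cK).
exists (K `|` r @` [set t | set_val t <= N]), N; split=> //.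
- apply: compactU => //; apply: continuous_compact.
    by apply: continuous_subspaceT; exact: baseray_continuous.
  exact: halfline_segment_compact.
- by move=> t; split=> [[/KN//|[u uN /rinj <- //]]|tN]; right; exists t.
Qed.

Section Tail.
Variables (L : set X) (N : RR).
Hypotheses (N0 : 0 <= N) (LN : forall t, L (r t) <-> set_val t <= N).

Let C := [set x : RR | N < x].

Fact tail_ge0 (x : subsp C) : 0 <= set_val x.
Proof. exact: le_trans N0 (ltW (set_valP x)). Qed.

Definition tail_halfline (x : subsp C) : halfline RR :=
  @in_subsp RR [set x : RR | 0 <= x] (set_val x) (tail_ge0 x).

Fact ray_tail_notin (x : subsp C) : (~` L) (r (tail_halfline x)).
Proof. by move=> /LN /=; apply/negP; rewrite -ltNge; exact: (set_valP x). Qed.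

Definition ray_tail (x : subsp C) : subsp (~` L) :=
  @in_subsp _ (~` L) _ (@ray_tail_notin x).

Lemma ray_tail_embedding : embedding ray_tail.
Proof.
apply: (@in_subsp_embedding _ _ _ (~` L)).
apply: (@embedding_comp _ _ _ tail_halfline r).
  by apply: (@in_subsp_embedding _ RR set_val); exact: set_val_embedding.
by case: hr.
Qed.

Lemma range_ray_tail : @end_pair X (range r) L = range ray_tail.
Proof.
apply/seteqP; split=> [x [t _ rt]|_ [x _ <-]]; last first.
  by exists (tail_halfline x).
have tN : C (set_val t).
  by rewrite /C /= ltNge; apply/negP => /LN; rewrite rt; exact: (set_valP x).
exists (in_subsp tN) => //; apply: val_inj; apply: (etrans _ rt) => /=.
by congr r; exact: val_inj.
Qed.

Lemma ray_tail_convex (x y a : RR) : C x -> C y -> 0 <= a <= 1 ->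
  C (a * x + (1 - a) * y).
Proof.
rewrite /C /= => Nx Ny /andP[a0 a1].
by have [xy|yx] := leP x y; nra.
Qed.

End Tail.
End Ray.

(** * End cohomology classes *)

Section EndCohomology.
Variables (RR : realType) (R : comNzRingType).

Definition pairmap_comp (S T U : topologicalType) (A : set S) (B : set T)
    (C : set U) (g : Defs.pairmap B C) (f : Defs.pairmap A B) :
    Defs.pairmap A C :=
  @PairMap S U A C (g \o f) (fun x Ax => pm_sub g (pm_sub f Ax)).

Section EndClass.
Variables (X : topologicalType) (A : set X) (k : nat).

(** [dirlim_in] with its source displayed as the cohomology of a pair, so that lemmas on [cohom_map]
    apply to its argument. *)
Definition end_class (K : compactum X)
    (x : cohom RR R (@end_pair X A (set_val K)) k) : end_cohom RR R A k :=
  @dirlim_in R (end_system RR R A k) K x.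

Lemma end_class_surj (u : end_cohom RR R A k) :
  exists (K : compactum X) (x : cohom RR R (@end_pair X A (set_val K)) k),
    u = end_class x.
Proof.
by have [K [x ->]] := @dirlim_surj R (end_system RR R A k) u; exists K, x.
Qed.

Lemma end_classP (K L : compactum X)
    (x : cohom RR R (@end_pair X A (set_val K)) k)
    (y : cohom RR R (@end_pair X A (set_val L)) k) :
  end_class x = end_class y <->
  exists (M : compactum X) (KM : compacta_le K M) (LM : compacta_le L M),
    cohom_map RR R (end_pair_incl A KM) k x =
    cohom_map RR R (end_pair_incl A LM) k y.
Proof. exact: dirlim_inP. Qed.

Lemma end_class_incl (K L : compactum X) (KL : compacta_le K L)
    (x : cohom RR R (@end_pair X A (set_val K)) k) :
  end_class (K := L) (cohom_map RR R (end_pair_incl A KL) k x) = end_class x.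
Proof. exact: (@dirlim_in_map _ (end_system RR R A k)). Qed.

Fact end_class_is_linear K : linear (@end_class K).
Proof. by move=> a x y; exact: dirlim_in_is_linear. Qed.

HB.instance Definition _ K := GRing.isLinear.Build R
  (cohom RR R (@end_pair X A (set_val K)) k) (end_cohom RR R A k) *:%R
  (@end_class K) (@end_class_is_linear K).

End EndClass.

Lemma end_cohom_mapE (Y X : topologicalType) (B : set Y) (A : set X)
    (f : proper_pairmap B A) k (K : compactum X)
    (x : cohom RR R (@end_pair X A (set_val K)) k) :
  end_cohom_map RR R f k (end_class x) =
  @end_class Y B k (compacta_preimage f K)
    (cohom_map RR R (end_pair_map f (set_val K)) k x).
Proof. exact: dirlim_mapE. Qed.

Lemma end_cohom_map_comp (Z Y X : topologicalType) (C : set Z) (B : set Y)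
    (A : set X) (f : proper_pairmap C B) (g : proper_pairmap B A)
    (h : proper_pairmap C A) k (u : end_cohom RR R A k) :
  h =1 g \o f ->
  end_cohom_map RR R f k (end_cohom_map RR R g k u) = end_cohom_map RR R h k u.
Proof.
move=> hE; have [K [x ->]] := end_class_surj u.
rewrite !end_cohom_mapE; apply/end_classP.
(* [h] agrees with [g \o f] only pointwise, so the two preimages of [K] are distinct indices,
   compared by inclusion. *)
have le1 : compacta_le (compacta_preimage f (compacta_preimage g K))
    (compacta_preimage h K).
  move=> z Kz; change (set_val K (h z)); rewrite hE; exact: Kz.
exists (compacta_preimage h K), le1, (@compacta_le_refl _ _).
pose gf := pairmap_comp (end_pair_map g (set_val K))
  (end_pair_map f (g @^-1` set_val K)).
rewrite (@cohom_map_comp _ _ _ _ _ _ _ _ _ _ _ gf) //.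
rewrite (@cohom_map_comp _ _ _ _ _ _ _ _ _ _ _ (end_pair_map h (set_val K))).
  rewrite (@cohom_map_comp _ _ _ _ _ _ _ _ _ _ _ (end_pair_map h (set_val K))) //.
  by move=> z; exact: val_inj.
by move=> z; apply: val_inj; rewrite /= hE.
Qed.

(** Every simplex lies in the subspace, so relative cocycles are already zero at each stage. *)
Lemma end_cohom_full (X : topologicalType) (A : set X) k
    (u : end_cohom RR R A k) : (forall x, A x) -> u = 0.
Proof.
move=> At; have [K [x ->]] := end_class_surj u.
suff -> : x = 0 by rewrite linear0.
have [z ->] := lmod_class_surj x.
suff -> : z = 0 by rewrite linear0.
apply: val_inj; apply/funext => s; have /asboolP[z0 _] := cocycleP z.
by apply: z0 => t _; exact: At.
Qed.

Fact end_pair_set0 (X : topologicalType) (K : set X) x : ~ @end_pair X set0 K x.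
Proof. by []. Qed.

Section ConstantEndClass.
Variables (X : topologicalType).

Definition cst_end (a : R) : end_cohom RR R (set0 : set X) 0 :=
  @end_class X set0 0 (to_compactum (@compact0 X))
    (cst_class RR (@end_pair_set0 X _) a).

Lemma cst_endE (K : compactum X) a :
  @end_class X set0 0 K (cst_class RR (@end_pair_set0 X (set_val K)) a) =
  cst_end a.
Proof.
have K0 : compacta_le (to_compactum (@compact0 X)) K by [].
rewrite /cst_end -(end_class_incl K0).
by rewrite (cohom_map_cst RR (@end_pair_set0 _ (set_val K))).
Qed.

Fact cst_end_is_linear : linear (cst_end : R^o -> _).
Proof.
move=> a x y; rewrite /cst_end -linearP; congr end_class.
exact: cst_class_is_linear.
Qed.

HB.instance Definition _ := GRing.isLinear.Build R R^o
  (end_cohom RR R (set0 : set X) 0) *:%R cst_end cst_end_is_linear.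

End ConstantEndClass.

Lemma end_cohom_map_cst (Y X : topologicalType)
    (f : proper_pairmap (set0 : set Y) (set0 : set X)) a :
  end_cohom_map RR R f 0 (cst_end X a) = cst_end Y a.
Proof.
rewrite [in LHS]/cst_end end_cohom_mapE (cohom_map_cst RR (@end_pair_set0 _ _)).
exact: (cst_endE (compacta_preimage f (to_compactum (@compact0 X)))).
Qed.

(** The half line is not compact: a constant that dies in the limit vanishes off a compactum bounded
    by [N], and evaluation at [N + 1] recovers it. *)
Lemma cst_end_inj (a : R) : cst_end (halfline RR) a = 0 -> a = 0.
Proof.
rewrite /cst_end.
rewrite -(linear0 (@end_class _ set0 0 (to_compactum (@compact0 _)))).
move=> /end_classP[K [h1 [h2]]]; rewrite linear0.
rewrite (cohom_map_cst RR (@end_pair_set0 _ _)) /cst_class.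
have [N N0 KN] := halfline_compact_bounded (set_valP K).
have N1 : 0 <= N + 1 by rewrite addr_ge0.
pose t : halfline RR := @in_subsp RR [set x : RR | 0 <= x] (N + 1) N1.
have tK : (~` set_val K) t by move=> /KN /=; apply/negP; rewrite -ltNge ltrDl.
rewrite -(linear0 (lmod_class _)) => /lmod_classP; rewrite subr0.
rewrite /coboundaries unfold_in => /eqP /(congr1 val) /=.
move=> a0; pose s : ssimplex RR (subsp (~` set_val K)) 0 :=
  cst (@in_subsp _ (~` set_val K) t tK).
exact: (congr1 (fun phi : cochain RR R _ 0 => phi s) a0).
Qed.

End EndCohomology.

(** * The splitting *)

Section Splitting.
Variables (RR : realType) (R : comNzRingType).

Section ForgetPair.
Variables (X : topologicalType) (A : set X).

Fact idfun_proper : proper_map (idfun : X -> X).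
Proof. by []. Qed.

Definition forget_pair : proper_pairmap (set0 : set X) A :=
  ProperPairMap
    (ppm_map := @PairMap X X set0 A idfun (fun x => @False_ind (A x)))
    idfun_proper.

(** The map from relative to absolute cohomology in the long exact sequence of the pair. *)
Definition forget k := end_cohom_map RR R forget_pair k.

End ForgetPair.

Section Ray.
Variables (X : topologicalType) (r : halfline RR -> X) (hr : baseray r).

(** Cofinality in the form used below: any class of the limit can be moved to such an [L], where the
    lemmas on convex pairs apply. *)
Lemma ray_tail_pair (K : compactum X) : exists (L : compactum X) (C : set RR)
    (q : continuousType (subsp C) (subsp (~` set_val L))),
  [/\ compacta_le K L,
      forall x y a : RR, C x -> C y -> 0 <= a <= 1 -> C (a * x + (1 - a) * y),
      C !=set0, embedding q & @end_pair X (range r) (set_val L) = range q].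
Proof.
have [L [N [cL KL N0 LN]]] := ray_cofinal hr (set_valP K).
have qemb := ray_tail_embedding hr N0 LN.
exists (to_compactum cL), [set x : RR | N < x].
exists (mkcts (let: And3 h _ _ := qemb in h)); split=> //.
- exact: ray_tail_convex.
- by exists (N + 1); rewrite /= ltrDl.
- exact: range_ray_tail.
Qed.

Lemma forget_inj k (u : end_cohom RR R (range r) k) :
  forget (range r) k u = 0 -> u = 0.
Proof.
have [K [x ->]] := end_class_surj u; rewrite /forget end_cohom_mapE.
rewrite -(linear0 (@end_class RR R X set0 k
  (compacta_preimage (forget_pair (range r)) K))).
move=> /end_classP[M [KM [KM']]]; rewrite linear0 => xM0.
(* The absolute class of [x] dies off [M], hence also off the larger [L], where injectivity is
   available. *)
have [L [C [q [ML convC [p Cp] qemb rq]]]] := ray_tail_pair M.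
have KL : compacta_le K L := compacta_le_trans KM ML.
rewrite -(end_class_incl KL).
suff -> : cohom_map RR R (end_pair_incl (range r) KL) k x = 0.
  by rewrite linear0.
apply: (@convex_pair_inj RR R C convC _ q qemb _ (@end_pair X set0 (set_val L))
  (end_pair_map (forget_pair (range r)) (set_val L)) rq _ k (in_subsp Cp)).
  by move=> y; exact: val_inj.
rewrite -(linear0 (cohom_map RR R (end_pair_incl set0 ML) k)) -xM0.
(* Restricting and forgetting commute: all the composites are the identity on points. *)
pose h := pairmap_comp (end_pair_map (forget_pair (range r)) (set_val K))
  (end_pair_incl set0 KL).
pose h' := pairmap_comp (end_pair_map (forget_pair (range r)) (set_val K))
  (end_pair_incl set0 KM).
rewrite (@cohom_map_comp _ _ _ _ _ _ _ _ _ _ _ h); last first.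
  by move=> y; exact: val_inj.
rewrite (@cohom_map_comp _ _ _ _ _ _ _ _ _ _ _ h'); last first.
  by move=> y; exact: val_inj.
by rewrite (@cohom_map_comp _ _ _ _ _ _ _ _ _ _ _ h) // => y; exact: val_inj.
Qed.

(** The preimage of [K] under the identity is [K] as a set, but with another compactness proof,
    hence another index. *)
Lemma end_class_forget k (K : compactum X) (A : set X)
    (x : cohom RR R (@end_pair X A (set_val K)) k) :
  @end_class RR R X set0 k K
    (cohom_map RR R (end_pair_map (forget_pair A) (set_val K)) k x) =
  forget A k (end_class x).
Proof.
rewrite /forget end_cohom_mapE; apply/end_classP.
by exists K, (@compacta_le_refl _ K), (@compacta_le_refl _ K).
Qed.

Lemma forget_surj k (c : end_cohom RR R (set0 : set X) k.+1) :
  exists u, c = forget (range r) k.+1 u.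
Proof.
have [K [x ->]] := end_class_surj c.
have [L [C [q [KL convC [p Cp] qemb rq]]]] := ray_tail_pair K.
have [|y xy] := @convex_pair_surj RR R C convC _ q qemb _
  (@end_pair X set0 (set_val L))
  (end_pair_map (forget_pair (range r)) (set_val L)) rq
  (@end_pair_set0 _ _) _ k (in_subsp Cp)
  (cohom_map RR R (end_pair_incl set0 KL) k.+1 x).
  by move=> y; exact: val_inj.
by exists (end_class y); rewrite -end_class_forget -(end_class_incl KL) xy.
Qed.

Lemma forget_split0 (c : end_cohom RR R (set0 : set X) 0) :
  exists u a, c = forget (range r) 0 u + cst_end RR X a.
Proof.
have [K [x ->]] := end_class_surj c.
have [L [C [q [KL convC [p Cp] qemb rq]]]] := ray_tail_pair K.
have [|y [a xy]] := @convex_pair_split0 RR R C convC _ q qemb _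
  (@end_pair X set0 (set_val L))
  (end_pair_map (forget_pair (range r)) (set_val L)) rq
  (@end_pair_set0 _ _) _ (in_subsp Cp)
  (cohom_map RR R (end_pair_incl set0 KL) 0 x).
  by move=> y; exact: val_inj.
exists (end_class y), a.
rewrite -end_class_forget -(end_class_incl KL) xy linearD; congr (_ + _).
exact: cst_endE.
Qed.

Fact ray_pair_subproof t : range r (r t).
Proof. by exists t. Qed.

Let rc : continuousType (halfline RR) X := mkcts (baseray_continuous hr).

Definition ray_pair : proper_pairmap (set0 : set (halfline RR)) (set0 : set X) :=
  ProperPairMap (ppm_map := @PairMap _ _ set0 set0 rc (fun _ => id)) hr.1.

Definition ray_full_pair : proper_pairmap [set: halfline RR] (range r) :=
  ProperPairMap (ppm_map := @PairMap _ _ setT (range r) rc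
    (fun t _ => ray_pair_subproof t)) hr.1.

Definition ray_cross_pair : proper_pairmap (set0 : set (halfline RR)) (range r) :=
  ProperPairMap (ppm_map := @PairMap _ _ set0 (range r) rc
    (fun t _ => ray_pair_subproof t)) hr.1.

(** Restricting a relative class to the ray factors through the end cohomology of the half line
    relative to itself, which is zero. *)
Lemma ray_pair_forget k (u : end_cohom RR R (range r) k) :
  end_cohom_map RR R ray_pair k (forget (range r) k u) = 0.
Proof.
rewrite (@end_cohom_map_comp _ _ _ _ _ _ _ _ _ _ ray_cross_pair) //.
rewrite -(@end_cohom_map_comp _ _ _ _ _ _ _ _ (forget_pair setT) ray_full_pair) //.
by rewrite [X in end_cohom_map _ _ _ _ X]end_cohom_full // linear0.
Qed.

End Ray.

(** * End cohomology of the half line *)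

Lemma baseray_idfun : baseray (idfun : halfline RR -> halfline RR).
Proof.
by split=> //; split; [move=> t| |move=> U oU; exists U].
Qed.

Lemma halfline_end_cohom_pos k (c : He RR R (halfline RR) k.+1) : c = 0.
Proof.
have [u ->] := forget_surj baseray_idfun c.
by rewrite (@end_cohom_full _ _ _ _ _ u) ?linear0 // => t; exists t.
Qed.

Lemma halfline_end_cohom0 (c : He RR R (halfline RR) 0) :
  exists a, c = cst_end RR (halfline RR) a.
Proof.
have [u [a ->]] := forget_split0 baseray_idfun c; exists a.
by rewrite (@end_cohom_full _ _ _ _ _ u) ?linear0 ?add0r // => t; exists t.
Qed.


(** A sigma type makes the inverse data, available for all spaces and degrees at once. *)
Lemma linear_bijective_inv (V W : lmodType R) (f : {linear V -> W}) :
  injective f -> (forall w, exists v, w = f v) ->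
  {g : {linear W -> V} | cancel f g & cancel g f}.
Proof.
move=> finj /choice[g gE]; have gK : cancel g f by move=> w; rewrite -gE.
have fK : cancel f g by move=> v; apply: finj; rewrite gK.
have glin : linear g := can2_linear fK gK.
by exists (HB.pack_for {linear W -> V} g (GRing.isLinear.Build _ _ _ _ g glin)).
Qed.

(** Inverse of the isomorphism from [R] to the degree [0] end cohomology of the half line given by
    constants. *)
Definition cst_value (c : He RR R (halfline RR) 0) : R :=
  projT1 (cid (halfline_end_cohom0 c)).

Lemma cst_valueK : cancel cst_value (cst_end RR (halfline RR)).
Proof. by move=> c; rewrite /cst_value; case: cid. Qed.

Lemma cst_end_halfline_inj :
  injective (cst_end RR (halfline RR) : R -> He RR R (halfline RR) 0).
Proof. exact: (raddf_inj (@cst_end_inj RR R)). Qed.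

(** * The splitting map and its naturality *)

Section SplittingMap.
Variables (X : topologicalType) (r : halfline RR -> X) (hr : baseray r).

(** A section of restriction to the ray whose definition does not mention the ray; in positive
    degrees its source is zero. *)
Definition cst_section_fun k : He RR R (halfline RR) k -> He RR R X k :=
  if k is 0 then fun c => cst_end RR X (cst_value c) else fun=> 0.

Fact cst_section_is_linear k : linear (@cst_section_fun k).
Proof.
case: k => [|k] a x y /=; last by rewrite scaler0 addr0.
transitivity (cst_end RR X (a * cst_value x + cst_value y)); last first.
  exact: cst_end_is_linear.
congr (cst_end RR X _); apply: cst_end_halfline_inj.
by rewrite cst_valueK [RHS]cst_end_is_linear !cst_valueK.
Qed.

HB.instance Definition _ k := GRing.isLinear.Build R
  (He RR R (halfline RR) k) (He RR R X k) *:%R (@cst_section_fun k)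
  (@cst_section_is_linear k).

Definition splitting_fun k
    (c : (end_cohom RR R (range r) k * He RR R (halfline RR) k)%type) :
    He RR R X k :=
  forget (range r) k c.1 + cst_section_fun c.2.

Fact splitting_is_linear k : linear (@splitting_fun k).
Proof.
move=> a x y; rewrite /splitting_fun !linearP /= scalerDr.
by rewrite !addrA; congr (_ + _); rewrite addrAC.
Qed.

HB.instance Definition _ k := GRing.isLinear.Build R
  (end_cohom RR R (range r) k * He RR R (halfline RR) k)%type (He RR R X k)
  *:%R (@splitting_fun k) (@splitting_is_linear k).

Lemma ray_pair_section k (c : He RR R (halfline RR) k) :
  end_cohom_map RR R (ray_pair hr) k (cst_section_fun c) = c.
Proof.
case: k c => [|k] c; last by rewrite [RHS]halfline_end_cohom_pos; exact: linear0.
by rewrite end_cohom_map_cst cst_valueK.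
Qed.

(** Restriction to the ray kills the first summand and recovers the second, which leaves injectivity
    of [forget]. *)
Lemma splitting_inj k : injective (@splitting_fun k).
Proof.
apply: raddf_inj => -[u c]; move=> uc0.
have c0 : c = 0.
  have := congr1 (end_cohom_map RR R (ray_pair hr) k) uc0.
  rewrite [X in X = _]linearD [X in _ = X]linear0.
  by rewrite ray_pair_forget add0r ray_pair_section.
have s0 : cst_section_fun (0 : He RR R (halfline RR) k) = 0 by exact: linear0.
move: uc0; rewrite c0 /= /splitting_fun s0 addr0 => /(forget_inj hr) /= ->.
by [].
Qed.

Lemma splitting_surj k (c : He RR R X k) : exists u, c = splitting_fun u.
Proof.
case: k c => [|k] c.
  have [u [a ->]] := forget_split0 hr c.
  exists (u, cst_end RR (halfline RR) a); rewrite /splitting_fun /=.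
  by congr (_ + cst_end RR X _); apply: cst_end_halfline_inj; rewrite cst_valueK.
have [u ->] := forget_surj hr c.
by exists (u, 0); rewrite /splitting_fun /= addr0.
Qed.

End SplittingMap.

(** Both sides are induced by [f] seen as a map from [Y] with the empty subspace to [X] with its
    ray. *)
Lemma He_map_forget (Y X : ray_based RR) (f : ray_map Y X) k
    (u : rHe R X k) :
  He_map R f k (forget (range (rb_ray X)) k u) =
  forget (range (rb_ray Y)) k (rHe_map R f k u).
Proof.
pose h : proper_pairmap (set0 : set Y) (range (rb_ray X)) :=
  ProperPairMap (ppm_map := @PairMap Y X set0 _ f (fun x => @False_ind _))
    (rm_proper f).
rewrite /He_map /rHe_map (@end_cohom_map_comp _ _ _ _ _ _ _ _ _ _ h) //.
by rewrite (@end_cohom_map_comp _ _ _ _ _ _ _ _ _ _ h).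
Qed.

Lemma He_map_section (Y X : ray_based RR) (f : ray_map Y X) k
    (c : He RR R (halfline RR) k) :
  He_map R f k (cst_section_fun X c) = cst_section_fun Y c.
Proof.
case: k c => [|k] c; last exact: linear0.
exact: end_cohom_map_cst.
Qed.

Lemma He_map_splitting (Y X : ray_based RR) (f : ray_map Y X) k
    (u : (rHe R X k * He RR R (halfline RR) k)%type) :
  He_map R f k (splitting_fun u) = splitting_fun (rHe_map R f k u.1, u.2).
Proof.
transitivity (He_map R f k (forget (range (rb_ray X)) k u.1) +
              He_map R f k (cst_section_fun X u.2)); first exact: linearD.
by rewrite He_map_forget He_map_section.
Qed.

End Splitting.

Theorem theorem7p3 (RR : realType) (R : idomainType) (hR : is_pid R) :
  (exists Phi : forall (X : ray_based RR) (k : nat),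
      {linear He RR R X k -> (rHe R X k * He RR R (halfline RR) k)%type},
    (forall (X : ray_based RR) (k : nat), bijective (Phi X k)) /\
    (forall (Y X : ray_based RR) (f : ray_map Y X) (k : nat) (c : He RR R X k),
      Phi Y k (He_map R f k c) =
      (rHe_map R f k (Phi X k c).1, (Phi X k c).2))) /\
  (forall (X : ray_based RR) (k : nat), (0 < k)%N ->
    exists g : {linear He RR R X k -> rHe R X k}, bijective g).
Proof.
split; last first.
  move=> X [//|k] _; have hr := rb_baseray X.
  (* In positive degrees [forget] alone is bijective. *)
  have [g fK gK] := linear_bijective_inv
    (raddf_inj (@forget_inj RR R _ _ hr k.+1))
    (@forget_surj RR R _ _ hr k).
  by exists g; exists (forget RR R (range (rb_ray X)) k.+1).
(* The explicit map runs from the direct sum to absolute cohomology; the splitting is its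
   inverse. *)
pose Psi (X : ray_based RR) k := @splitting_fun RR R X (rb_ray X) k.
pose inv (X : ray_based RR) k := @linear_bijective_inv R _ _ _
  (@splitting_inj RR R X _ (rb_baseray X) k)
  (@splitting_surj RR R X _ (rb_baseray X) k).
pose Phi (X : ray_based RR) k := s2val (inv X k).
have PhiK X k : cancel (Phi X k) (Psi X k) := s2valP' (inv X k).
have PsiK X k : cancel (Psi X k) (Phi X k) := s2valP (inv X k).
exists Phi; split=> [X k|Y X f k c].
  exact: (Bijective (PhiK X k) (PsiK X k)).
(* Injectivity of [Psi] transfers its naturality to the inverse. *)
apply: (can_inj (PsiK Y k)); rewrite PhiK.
by rewrite -{1}[c]PhiK; exact: He_map_splitting.
Qed.
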